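(* Let $H:\mathbb{R}^2\to\mathbb{R}$ be a smooth function and let $\Omega\subset\mathbb{R}^2$ be open and simply connected. (a) There exists a twin correspondence between graphs over $\Omega$ with prescribed mean curvature $H$ in the Euclidean space $\mathbb{R}^3$ and maximal graphs over $\Omega$ in the generalized Heisenberg spacetime $\mathrm{Nil}^3_1(H)=\mathbb{L}^3(\mathbb{E}^2,H)$. That is: for every $f\in\mathcal{C}^2(\Omega)$ whose graph in $\mathbb{R}^3$ has mean curvature $H$, there exists $g\in\mathcal{C}^2(\Omega)$ whose graph in $\mathrm{Nil}^3_1(H)$ is spacelike with zero mean curvature and such that $f,g$ satisfy the twin relations with $(\tau_1,\tau_2)=(0,H)$; and conversely, for every such $g$ there exists such an $f$ satisfying the twin relations with $g$. (b) There exists a twin correspondence between spacelike graphs over $\Omega$ with prescribed mean curvature $H$ in the Lorentz–Minkowski space $\mathbb{L}^3$ and minimal graphs over $\Omega$ in the generalized Heisenberg space $\mathrm{Nil}^3(H)=\mathbb{E}^3(\mathbb{E}^2,H)$. That is: for every $g\in\mathcal{C}^2(\Omega)$ whose graph in $\mathbb{L}^3$ is spacelike with mean curvature $H$, there exists $f\in\mathcal{C}^2(\Omega)$ whose graph in $\mathrm{Nil}^3(H)$ has zero mean curvature and such that $f,g$ satisfy the twin relations with $(\tau_1,\tau_2)=(H,0)$; and conversely, for every such $f$ there exists such a $g$ satisfying the twin relations with $f$.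
   Context: For a smooth function $\sigma:\mathbb{R}^2\to\mathbb{R}$ let $$\mathbf{C}_\sigma(x,y)=2\int_0^1 t\,\sigma(tx,ty)\,dt .$$ $\mathbb{E}^3(\mathbb{E}^2,\sigma)$ (with $\epsilon=1$, Riemannian) and $\mathbb{L}^3(\mathbb{E}^2,\sigma)$ (with $\epsilon=-1$, Lorentzian) denote $\mathbb{R}^3$, with coordinates $(x,y,z)$, endowed with the metric $$dx^2+dy^2+\epsilon\left(dz+\epsilon\,\mathbf{C}_\sigma(x,y)(y\,dx-x\,dy)\right)^2 .$$ For $\sigma=0$ these are the Euclidean space $\mathbb{R}^3$ and the Lorentz–Minkowski space $\mathbb{L}^3=(\mathbb{R}^3,dx^2+dy^2-dz^2)$. The graph of $u\in\mathcal{C}^2(\Omega)$ is $\{(x,y,u(x,y)):(x,y)\in\Omega\}$. It is spacelike in the Lorentzian case if its induced metric is Riemannian. Mean curvatures are taken with respect to the upward-pointing unit normal: - In $\mathbb{E}^3(\mathbb{E}^2,\sigma)$, the mean curvature $h$ satisfies $2h=\partial_x(a/w)+\partial_y(b/w)$ with $a=u_x+y\,\mathbf{C}_\sigma$, $b=u_y-x\,\mathbf{C}_\sigma$, $w=\sqrt{1+a^2+b^2}$. - In $\mathbb{L}^3(\mathbb{E}^2,\sigma)$, the graph is spacelike if and only if $1-\widetilde a^2-\widetilde b^2>0$, and its mean curvature $\widetilde h$ satisfies $2\widetilde h=\partial_x(\widetilde a/\widetilde w)+\partial_y(\widetilde b/\widetilde w)$ with $\widetilde a=u_x-y\,\mathbf{C}_\sigma$,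 $\widetilde b=u_y+x\,\mathbf{C}_\sigma$, $\widetilde w=\sqrt{1-\widetilde a^2-\widetilde b^2}$. Minimal (respectively maximal) graphs are graphs (respectively spacelike graphs) with zero mean curvature. Twin relations: for the graph of $f$ in $\mathbb{E}^3(\mathbb{E}^2,\tau_1)$ and the spacelike graph of $g$ in $\mathbb{L}^3(\mathbb{E}^2,\tau_2)$, put $(\alpha,\beta)=(f_x+y\,\mathbf{C}_{\tau_1},\,f_y-x\,\mathbf{C}_{\tau_1})$, $\omega=\sqrt{1+\alpha^2+\beta^2}$, $(\widetilde\alpha,\widetilde\beta)=(g_x-y\,\mathbf{C}_{\tau_2},\,g_y+x\,\mathbf{C}_{\tau_2})$, $\widetilde\omega=\sqrt{1-\widetilde\alpha^2-\widetilde\beta^2}$. The twin relations are $(\widetilde\alpha,\widetilde\beta)=\left(-\frac{\beta}{\omega},\frac{\alpha}{\omega}\right)$, or equivalently $(\alpha,\beta)=\left(\frac{\widetilde\beta}{\widetilde\omega},-\frac{\widetilde\alpha}{\widetilde\omega}\right)$. *)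

(* Defs.v *)
(* Stdlib reals with Coquelicot. *)
From Stdlib Require Import Reals.
From Coquelicot Require Import Coquelicot.
Open Scope R_scope.

Definition pdx (f : R -> R -> R) (x y : R) : R := Derive (fun t => f t y) x.
Definition pdy (f : R -> R -> R) (x y : R) : R := Derive (fun t => f x t) y.

(* On an open [Om], [ex_diff_n f k] at all points of [Om] says that [f] is of
   class C^k there; the values of [f] outside [Om] are irrelevant. *)
Definition Ck_on (k : nat) (Om : R * R -> Prop) (f : R -> R -> R) : Prop :=
  forall x y, Om (x, y) -> ex_diff_n f k x y.

Definition smooth (f : R -> R -> R) : Prop :=
  forall (k : nat) (x y : R), ex_diff_n f k x y.

Definition unit_interval (t : R) : Prop := 0 <= t <= 1.
Definition unit_square (p : R * R) : Prop :=
  unit_interval (fst p) /\ unit_interval (snd p).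

Definition path_in (Om : R * R -> Prop) (c : R -> R * R) : Prop :=
  continuous_on unit_interval c /\ forall t, unit_interval t -> Om (c t).

Definition path_connected (Om : R * R -> Prop) : Prop :=
  forall p q, Om p -> Om q ->
    exists c, path_in Om c /\ c 0 = p /\ c 1 = q.

(* Homotopies of loops fix the base point; [K (s, t)] is the point of
   parameter [t] on the loop of time [s]. *)
Definition null_homotopic (Om : R * R -> Prop) (c : R -> R * R) : Prop :=
  exists K : R * R -> R * R,
    continuous_on unit_square K /\
    (forall p, unit_square p -> Om (K p)) /\
    (forall t, unit_interval t -> K (0, t) = c t /\ K (1, t) = c 0) /\
    (forall s, unit_interval s -> K (s, 0) = c 0 /\ K (s, 1) = c 0).

Definition simply_connected (Om : R * R -> Prop) : Prop :=
  path_connected Om /\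
  forall c, path_in Om c -> c 0 = c 1 -> null_homotopic Om c.

(* Points of R^3 and tangent vectors, in the coordinates (x, y, z). *)
Definition vec3 : Type := (R * R * R)%type.
Definition cx (v : vec3) : R := fst (fst v).
Definition cy (v : vec3) : R := snd (fst v).
Definition cz (v : vec3) : R := snd v.

(* [g p v w] is the scalar product at [p] of the tangent vectors [v], [w]. *)
Definition metric : Type := vec3 -> vec3 -> vec3 -> R.

Definition Cfun (sigma : R -> R -> R) (x y : R) : R :=
  2 * RInt (fun t => t * sigma (t * x) (t * y)) 0 1.

(* The metric dx^2 + dy^2 + eps (dz + eps C_sigma (y dx - x dy))^2. *)
Definition bundle_form (eps : R) (sigma : R -> R -> R) (p v : vec3) : R :=
  cz v + eps * Cfun sigma (cx p) (cy p) * (cy p * cx v - cx p * cy v).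
Definition bundle_metric (eps : R) (sigma : R -> R -> R) : metric :=
  fun p v w => cx v * cx w + cy v * cy w
               + eps * (bundle_form eps sigma p v * bundle_form eps sigma p w).

Definition Euclid3 (sigma : R -> R -> R) : metric := bundle_metric 1 sigma.
Definition Lorentz3 (sigma : R -> R -> R) : metric := bundle_metric (-1) sigma.
Definition zero_fun (_ _ : R) : R := 0.

(* Derivative at [p] of [F] in the direction of the constant field [v]. *)
Definition dir_derive (F : vec3 -> R) (p v : vec3) : R :=
  Derive (fun t => F (plus p (scal t v))) 0.

(* [christoffel g p v w n] is g(nabla_v w, n) at [p], for the Levi-Civita
   connection nabla of [g] and [v], [w], [n] extended to constant vector fields
   of R^3 (Koszul formula; the Lie brackets vanish). *)
Definition christoffel (g : metric) (p v w n : vec3) : R :=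
  (dir_derive (fun q => g q w n) p v + dir_derive (fun q => g q v n) p w
   - dir_derive (fun q => g q v w) p n) / 2.

Definition graph_pt (u : R -> R -> R) (x y : R) : vec3 := (x, y, u x y).
Definition graph_X (u : R -> R -> R) (x y : R) : vec3 := (1, 0, pdx u x y).
Definition graph_Y (u : R -> R -> R) (x y : R) : vec3 := (0, 1, pdy u x y).

(* The third condition makes [N] unit, timelike if [eps = -1]; the last one
   says that [N] points into the region above the graph. *)
Definition upward_unit_normal (eps : R) (g : metric) (u : R -> R -> R)
    (x y : R) (N : vec3) : Prop :=
  let p := graph_pt u x y in
  g p N (graph_X u x y) = 0 /\ g p N (graph_Y u x y) = 0 /\
  g p N N = eps /\
  0 < cz N - pdx u x y * cx N - pdy u x y * cy N.

(* [has_mean_curvature eps g u x y h]: the mean curvature at (x, y) of the graph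
   of [u] is [h].  Here [I11], [I12], [I22] and [L11], [L12], [L22] are the
   coefficients of the first fundamental form and of the form
   (V, W) |-> g(nabla_V W, N).  Because of the factor [eps] = g(N, N), the mean
   curvature vector (half the trace of the normal part of nabla_V W) is h N
   in both signatures. *)
Definition has_mean_curvature (eps : R) (g : metric) (u : R -> R -> R)
    (x y h : R) : Prop :=
  exists N : vec3, upward_unit_normal eps g u x y N /\
    let p := graph_pt u x y in
    let X := graph_X u x y in
    let Y := graph_Y u x y in
    let I11 := g p X X in
    let I12 := g p X Y in
    let I22 := g p Y Y in
    let L11 := g p (0, 0, pdx (pdx u) x y) N + christoffel g p X X N in
    let L12 := g p (0, 0, pdy (pdx u) x y) N + christoffel g p X Y N in
    let L22 := g p (0, 0, pdy (pdy u) x y) N + christoffel g p Y Y N in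
    h = eps * (L11 * I22 - 2 * L12 * I12 + L22 * I11)
        / (2 * (I11 * I22 - I12 * I12)).

Definition spacelike_at (g : metric) (u : R -> R -> R) (x y : R) : Prop :=
  forall a b : R, (a, b) <> (0, 0) ->
    let V : vec3 := plus (scal a (graph_X u x y)) (scal b (graph_Y u x y)) in
    0 < g (graph_pt u x y) V V.

(* [sigma] determines the ambient space, [h] is the prescribed mean curvature. *)
Definition riem_graph (Om : R * R -> Prop) (sigma h u : R -> R -> R) : Prop :=
  Ck_on 2 Om u /\
  forall x y, Om (x, y) ->
    has_mean_curvature 1 (Euclid3 sigma) u x y (h x y).

Definition spacelike_graph (Om : R * R -> Prop) (sigma h u : R -> R -> R)
    : Prop :=
  Ck_on 2 Om u /\
  forall x y, Om (x, y) ->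
    spacelike_at (Lorentz3 sigma) u x y /\
    has_mean_curvature (-1) (Lorentz3 sigma) u x y (h x y).

Definition twin (Om : R * R -> Prop) (tau1 tau2 f g : R -> R -> R) : Prop :=
  forall x y, Om (x, y) ->
    let alpha := pdx f x y + y * Cfun tau1 x y in
    let beta := pdy f x y - x * Cfun tau1 x y in
    let omega := sqrt (1 + alpha ^ 2 + beta ^ 2) in
    let alpha' := pdx g x y - y * Cfun tau2 x y in
    let beta' := pdy g x y + x * Cfun tau2 x y in
    alpha' = - (beta / omega) /\ beta' = alpha / omega.

(* Main.v *)
Require Import Defs.
From Stdlib Require Import Reals Lra ClassicalEpsilon.
From Coquelicot Require Import Coquelicot.
Open Scope R_scope.

(* The mean curvature equation of a graph says that the field (a/w, b/w) has
   divergence 2h, while a_y - b_x = 2 eps sigma because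
   2C + x C_x + y C_y = 2 sigma for C = C_sigma.  Rotating (a/w, b/w) by a right
   angle turns the divergence equation into the closedness of a 1-form on the
   simply connected Om, whose potential is the twin graph; the field of the
   twin satisfies a'/w' = - eps b, b'/w' = eps a, so its divergence equation is
   the curl equation of the original graph.  Both signatures are treated at
   once, with a sign eps = 1 or -1.

   Since homotopies are only continuous, a potential of a closed form is
   obtained from dyadic Riemann-like sums of its local increments along paths:
   on a grid finer than a Lebesgue number these sums are exactly constant under
   refinement and under homotopy. *)

(** * Potentials of locally additive increments *)

(** Passing from [(eps, sigma, h)] to [(- eps, h, sigma)] is an involution: the mean curvature of a
    graph becomes the bundle curvature of the space of its twin, and conversely. One construction,
    run with each sign, therefore yields all four implications; in the statement one of the two
    functions is zero. The twin relations also force [w' = 1 / w], so the area element of the twin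
    is positive and its spacelikeness comes for free.

    A line integral along a merely continuous path need not make sense. The sums therefore use
    [J a b], the integral of the form along an L-shaped path from [a] to [b]: it depends on the end
    points alone and is exactly additive inside each square contained in [Om]. Balls of [R * R] are
    such squares.

    Mean curvature is given by the fundamental forms and the Levi-Civita connection, so the
    divergence equation has itself to be derived from the bundle metric; the only property of the
    sign used there is [eps * eps = 1]. *)

(** [J a b] stands for the increment of a primitive from [a] to [b]. It is a total function, but
    only its values on pairs of close points carry meaning. *)
Definition additive_near (J : R * R -> R * R -> R) (p : R * R) : Prop :=
  exists e : posreal, forall a b c,
    ball p e a -> ball p e b -> ball p e c -> J a b + J b c = J a c.

(** Recursive halving makes refinement, reversal and homotopy plain inductions on [k]. The order of
    [a] and [b] is free: with [b < a] the path is run backwards. *)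
Fixpoint dyadic_sum (J : R * R -> R * R -> R) (k : nat) (c : R -> R * R)
    (a b : R) : R :=
  match k with
  | O => J (c a) (c b)
  | S k => dyadic_sum J k c a ((a + b) / 2) + dyadic_sum J k c ((a + b) / 2) b
  end.

(** Affine changes of parameter preserve midpoints, hence the whole dyadic grid. A negative [m]
    covers reversed paths. *)
Lemma dyadic_sum_affine J k (c c' : R -> R * R) (m n : R) :
  forall a b, a <= b ->
  (forall t, a <= t <= b -> c t = c' (m * t + n)) ->
  dyadic_sum J k c a b = dyadic_sum J k c' (m * a + n) (m * b + n).
Proof.
  induction k as [|k IH]; intros a b Hab Hc; simpl.
  - rewrite !Hc by lra. reflexivity.
  - rewrite (IH a ((a + b) / 2)), (IH ((a + b) / 2) b)
      by (lra || (intros; apply Hc; lra)).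
    replace (m * ((a + b) / 2) + n) with ((m * a + n + (m * b + n)) / 2)
      by field.
    reflexivity.
Qed.

Lemma pow2_large (d : posreal) : exists k, 1 < d * 2 ^ k.
Proof.
  (* The bound is [2 / d] and not [1 / d] because it is attained only as a non-strict inequality. *)
  destruct (Pow_x_infinity 2 ltac:(rewrite Rabs_right; lra) (2 / d)) as [k Hk].
  exists k. specialize (Hk k (Nat.le_refl k)).
  rewrite Rabs_right in Hk by (apply Rle_ge, pow_le; lra).
  destruct d as [d Hd]; simpl in *.
  apply Rge_le in Hk. apply Rmult_le_compat_l with (r := d) in Hk; [|lra].
  replace (d * (2 / d)) with 2 in Hk by (field; lra). lra.
Qed.

Lemma pow2_mono k k' : (k <= k')%nat -> 2 ^ k <= 2 ^ k'.
Proof. intros H; apply Rle_pow; [lra|exact H]. Qed.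

(* A Lebesgue number for the cover of the square by the pullbacks under [K] of
   the balls on which [J] is additive. *)
Definition lebesgue_number (J : R * R -> R * R -> R) (K : R * R -> R * R)
    (d : R) : Prop :=
  forall x y, unit_square (x, y) ->
    exists p (e : posreal),
      (forall a b c, ball p e a -> ball p e b -> ball p e c ->
         J a b + J b c = J a c) /\
      (forall x' y', unit_square (x', y') -> Rabs (x' - x) < d ->
         Rabs (y' - y) < d -> ball p e (K (x', y'))).

Lemma lebesgue_number_exists J K :
  continuous_on unit_square K ->
  (forall p, unit_square p -> additive_near J (K p)) ->
  exists d : posreal, lebesgue_number J K d.
Proof.
  intros HK HJ.
  (* The factor 2 leaves room for the triangle inequality: a point close to [(x, y)], which is
     itself within [delta u v] of [(u, v)], must still be controlled. *)
  set (Q := fun (u v : R) (d : posreal) => unit_square (u, v) ->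
    exists e : posreal,
      (forall a b c, ball (K (u, v)) e a -> ball (K (u, v)) e b ->
         ball (K (u, v)) e c -> J a b + J b c = J a c) /\
      (forall x' y', unit_square (x', y') -> Rabs (x' - u) < 2 * d ->
         Rabs (y' - v) < 2 * d -> ball (K (u, v)) e (K (x', y')))).
  assert (HQ : forall u v, exists d, Q u v d).
  { intros u v. destruct (classic (unit_square (u, v))) as [Hu|Hu].
    2: { exists (mkposreal 1 Rlt_0_1). intros H; contradiction. }
    destruct (HJ _ Hu) as [e He].
    destruct (HK _ Hu (ball (K (u, v)) e)) as [d Hd].
    { exists e. intros z Hz; exact Hz. }
    assert (Hd2 : 0 < d / 2) by (destruct d; simpl; lra).
    exists (mkposreal _ Hd2). intros _. exists e. split; [exact He|].
    simpl. intros x' y' Hs Hx Hy. apply (Hd (x', y')); [|exact Hs].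
    split; simpl.
    - change (Rabs (x' - u) < d). lra.
    - change (Rabs (y' - v) < d). lra. }
  (* Compactness asks for a gauge on the whole plane, so the radii are picked by choice; outside the
     square [Q] holds vacuously. *)
  set (delta := fun u v => epsilon (inhabits (mkposreal 1 Rlt_0_1)) (Q u v)).
  assert (Hdelta : forall u v, Q u v (delta u v)).
  { intros u v. apply epsilon_spec, HQ. }
  destruct (compactness_value_2d 0 1 0 1 delta) as [d Hd].
  exists d. intros x y [Hx Hy].
  specialize (Hd x y Hx Hy). apply NNPP in Hd.
  destruct Hd as (u & v & Hu & Hv & Hxu & Hyv & Hle).
  destruct (Hdelta u v) as (e & He1 & He2); [split; assumption|].
  exists (K (u, v)), e. split; [exact He1|].
  intros x' y' Hs Hx' Hy'. apply He2; [exact Hs| |].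
  - replace (x' - u) with ((x' - x) + (x - u)) by ring.
    eapply Rle_lt_trans; [apply Rabs_triang|]. lra.
  - replace (y' - v) with ((y' - y) + (y - v)) by ring.
    eapply Rle_lt_trans; [apply Rabs_triang|]. lra.
Qed.

Lemma lebesgue_number_square J K d : 0 < d -> lebesgue_number J K d ->
  forall s0 s1 a b, 0 <= s0 -> s0 <= s1 < s0 + d -> s1 <= 1 ->
    0 <= a -> a <= b < a + d -> b <= 1 ->
    exists p (e : posreal),
      (forall a b c, ball p e a -> ball p e b -> ball p e c ->
         J a b + J b c = J a c) /\
      (forall x y, s0 <= x <= s1 -> a <= y <= b -> ball p e (K (x, y))).
Proof.
  intros Hd HL s0 s1 a b H0 H1 H2 H3 H4 H5.
  destruct (HL s0 a) as (p & e & He & HB).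
  { split; simpl; red; lra. }
  exists p, e. split; [exact He|].
  intros x y Hx Hy. apply HB.
  - split; simpl; red; lra.
  - rewrite Rabs_right; lra.
  - rewrite Rabs_right; lra.
Qed.

(** The two sides are the two routes along the boundary from the corner [(s0, a)] to [(s1, b)]. They
    agree on each quarter of the rectangle by induction, and the inner edges cancel. At [k = 0] the
    sides are shorter than [d], so the image of the rectangle lies in one ball where [J] is
    additive. *)
Lemma dyadic_boundary J K d : 0 < d -> lebesgue_number J K d ->
  forall k s0 s1 a b, 0 <= s0 -> s0 <= s1 < s0 + d * 2 ^ k -> s1 <= 1 ->
    0 <= a -> a <= b < a + d * 2 ^ k -> b <= 1 ->
    dyadic_sum J k (fun t => K (s0, t)) a b
    + dyadic_sum J k (fun s => K (s, b)) s0 s1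
    = dyadic_sum J k (fun s => K (s, a)) s0 s1
      + dyadic_sum J k (fun t => K (s1, t)) a b.
Proof.
  intros Hd HL. induction k as [|k IH]; intros s0 s1 a b H0 H1 H2 H3 H4 H5.
  - simpl in *. rewrite Rmult_1_r in *.
    destruct (lebesgue_number_square J K d Hd HL s0 s1 a b)
      as (p & e & He & HB); try assumption.
    rewrite !He; try (apply HB; lra). reflexivity.
  - simpl in *. set (s := (s0 + s1) / 2). set (m := (a + b) / 2).
    assert (Hs : s0 <= s <= s1) by (unfold s; lra).
    assert (Hm : a <= m <= b) by (unfold m; lra).
    pose proof (IH s0 s a m) as E1. pose proof (IH s0 s m b) as E2.
    pose proof (IH s s1 a m) as E3. pose proof (IH s s1 m b) as E4.
    assert (H00 : s < s0 + d * 2 ^ k) by (unfold s; lra).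
    assert (H01 : s1 < s + d * 2 ^ k) by (unfold s; lra).
    assert (H10 : m < a + d * 2 ^ k) by (unfold m; lra).
    assert (H11 : b < m + d * 2 ^ k) by (unfold m; lra).
    specialize (E1 ltac:(lra) ltac:(lra) ltac:(lra) ltac:(lra) ltac:(lra)
                  ltac:(lra)).
    specialize (E2 ltac:(lra) ltac:(lra) ltac:(lra) ltac:(lra) ltac:(lra)
                  ltac:(lra)).
    specialize (E3 ltac:(lra) ltac:(lra) ltac:(lra) ltac:(lra) ltac:(lra)
                  ltac:(lra)).
    specialize (E4 ltac:(lra) ltac:(lra) ltac:(lra) ltac:(lra) ltac:(lra)
                  ltac:(lra)).
    lra.
Qed.

Lemma additive_near_diag J p : additive_near J p -> J p p = 0.
Proof.
  intros [e He]. specialize (He p p p (ball_center _ _) (ball_center _ _)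
    (ball_center _ _)). lra.
Qed.

Lemma dyadic_sum_const J k p (c : R -> R * R) : J p p = 0 ->
  forall a b, a <= b -> (forall t, a <= t <= b -> c t = p) ->
  dyadic_sum J k c a b = 0.
Proof.
  intros HJ. induction k as [|k IH]; intros a b Hab Hc; simpl.
  - rewrite !Hc by lra. exact HJ.
  - rewrite !IH; try lra; intros; apply Hc; lra.
Qed.

(** In the boundary identity on the unit square, three sides are mapped to the base point and
    contribute zero; the fourth is the loop. *)
Lemma dyadic_sum_null_homotopic (Om : R * R -> Prop) J c :
  (forall p, Om p -> additive_near J p) ->
  path_in Om c -> null_homotopic Om c ->
  eventually (fun k => dyadic_sum J k c 0 1 = 0).
Proof.
  intros HJ [_ Hc] (K & HKc & HKO & HK1 & HK2).
  destruct (lebesgue_number_exists J K HKc) as [d Hd].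
  { intros p Hp. apply HJ, HKO, Hp. }
  destruct (pow2_large d) as [k0 Hk0].
  assert (J0 : J (c 0) (c 0) = 0).
  { apply additive_near_diag, HJ, Hc. red; lra. }
  exists k0. intros k Hk. apply pow2_mono in Hk.
  assert (Hk1 : 1 < d * 2 ^ k).
  { apply Rlt_le_trans with (1 := Hk0). apply Rmult_le_compat_l; [|exact Hk].
    apply Rlt_le, cond_pos. }
  pose proof (dyadic_boundary J K d (cond_pos d) Hd k 0 1 0 1
    ltac:(lra) ltac:(lra) ltac:(lra) ltac:(lra) ltac:(lra) ltac:(lra)) as E.
  rewrite (dyadic_sum_const J k _ (fun s => K (s, 1)) J0) in E;
    [|lra|intros s Hs; apply HK2, Hs].
  rewrite (dyadic_sum_const J k _ (fun s => K (s, 0)) J0) in E;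
    [|lra|intros s Hs; apply HK2, Hs].
  rewrite (dyadic_sum_const J k _ (fun t => K (1, t)) J0) in E;
    [|lra|intros t Ht; apply HK1, Ht].
  rewrite (dyadic_sum_affine J k (fun t => K (0, t)) c 1 0 0 1) in E;
    [|lra|intros t Ht; rewrite (proj1 (HK1 t Ht)); f_equal; ring].
  replace (1 * 0 + 0) with 0 in E by ring.
  replace (1 * 1 + 0) with 1 in E by ring. lra.
Qed.

(** A path is treated as a map of the square that ignores its first coordinate. *)
Lemma path_lebesgue (Om : R * R -> Prop) J c :
  (forall p, Om p -> additive_near J p) -> path_in Om c ->
  exists d : posreal, forall a b, 0 <= a -> a <= b < a + d -> b <= 1 ->
    exists p (e : posreal),
      (forall a b c, ball p e a -> ball p e b -> ball p e c ->
         J a b + J b c = J a c) /\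
      (forall y, a <= y <= b -> ball p e (c y)).
Proof.
  intros HJ [Hc1 Hc2].
  destruct (lebesgue_number_exists J (fun p => c (snd p))) as [d Hd].
  - intros [x y] [Hx Hy] P HP; simpl in *.
    destruct (Hc1 y Hy P HP) as [e He].
    exists e. intros [x' y'] [_ Hb] [_ Hs]; simpl in *. apply He; assumption.
  - intros [x y] [Hx Hy]; simpl in *. apply HJ, Hc2, Hy.
  - exists d. intros a b H1 H2 H3.
    destruct (lebesgue_number_square _ _ d (cond_pos d) Hd 0 0 a b)
      as (p & e & He & HB); try lra; try exact H2.
    exists p, e. split; [exact He|]. intros y Hy.
    apply (HB 0 y); lra.
Qed.

(** Once [d * 2 ^ k > 1], each interval of level [k] is mapped into a ball where [J] is additive, so
    inserting its midpoint changes nothing: the sums are stationary and no limit is taken. *)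
Lemma dyadic_sum_eventually_const (Om : R * R -> Prop) J c :
  (forall p, Om p -> additive_near J p) -> path_in Om c ->
  exists v, eventually (fun k => dyadic_sum J k c 0 1 = v).
Proof.
  intros HJ Hc.
  destruct (path_lebesgue Om J c HJ Hc) as [d Hd].
  assert (Href : forall k a b, 0 <= a -> a <= b < a + d * 2 ^ k -> b <= 1 ->
    dyadic_sum J (S k) c a b = dyadic_sum J k c a b).
  { induction k as [|k IH]; intros a b H1 H2 H3.
    - simpl in *. rewrite Rmult_1_r in H2.
      destruct (Hd a b H1 H2 H3) as (p & e & He & HB).
      apply He; apply HB; lra.
    - change (2 ^ S k) with (2 * 2 ^ k) in H2.
      change (dyadic_sum J (S k) c a ((a + b) / 2)
              + dyadic_sum J (S k) c ((a + b) / 2) b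
              = dyadic_sum J (S k) c a b).
      rewrite !IH by lra. reflexivity. }
  destruct (pow2_large d) as [k0 Hk0].
  exists (dyadic_sum J k0 c 0 1). exists k0. intros k Hk.
  induction Hk as [|k Hk IH]; [reflexivity|].
  rewrite Href; [exact IH|lra| |lra].
  apply pow2_mono in Hk.
  assert (d * 2 ^ k0 <= d * 2 ^ k).
  { apply Rmult_le_compat_l; [|exact Hk]. apply Rlt_le, cond_pos. }
  lra.
Qed.

(** On a fine grid, additivity on the triples [(a, b, a)] and [(a, a, a)] gives
    [J b a = - J a b]. *)
Lemma dyadic_sum_reverse (Om : R * R -> Prop) J c :
  (forall p, Om p -> additive_near J p) -> path_in Om c ->
  eventually (fun k => dyadic_sum J k c 1 0 = - dyadic_sum J k c 0 1).
Proof.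
  intros HJ Hc.
  destruct (path_lebesgue Om J c HJ Hc) as [d Hd].
  assert (Hrev : forall k a b, 0 <= a -> a <= b < a + d * 2 ^ k -> b <= 1 ->
    dyadic_sum J k c b a = - dyadic_sum J k c a b).
  { induction k as [|k IH]; intros a b H1 H2 H3; simpl in *.
    - rewrite Rmult_1_r in H2.
      destruct (Hd a b H1 H2 H3) as (p & e & He & HB).
      assert (Ha : ball p e (c a)) by (apply HB; lra).
      assert (Hb : ball p e (c b)) by (apply HB; lra).
      pose proof (He _ _ _ Ha Hb Ha). pose proof (He _ _ _ Ha Ha Ha). lra.
    - rewrite (Rplus_comm b a).
      rewrite (IH a ((a + b) / 2)), (IH ((a + b) / 2) b) by lra. ring. }
  destruct (pow2_large d) as [k0 Hk0]. exists k0. intros k Hk.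
  apply Hrev; [lra| |lra].
  apply pow2_mono in Hk.
  assert (d * 2 ^ k0 <= d * 2 ^ k).
  { apply Rmult_le_compat_l; [|exact Hk]. apply Rlt_le, cond_pos. }
  lra.
Qed.

(** * Concatenation, reversal and path independence *)

Definition concat_path (c c' : R -> R * R) (t : R) : R * R :=
  if Rle_dec t (1 / 2) then c (2 * t) else c' (2 * t - 1).

Lemma concat_path_in (Om : R * R -> Prop) c c' :
  path_in Om c -> path_in Om c' -> c 1 = c' 0 -> path_in Om (concat_path c c').
Proof.
  intros [Hc HO] [Hc' HO'] He. split.
  - intros t Ht P HP. unfold unit_interval in *.
    (* Neighbourhoods are built separately on the two sides of the junction and intersected at
       [1 / 2], where [c 1 = c' 0] makes both halves take the same value. *)
    assert (Hl : t <= 1 / 2 -> exists d : posreal, forall s, Rabs (s - t) < d ->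
       0 <= s <= 1 -> s <= 1 / 2 -> P (concat_path c c' s)).
    { intros Hle. unfold concat_path in HP. destruct (Rle_dec t (1 / 2)); [|lra].
      destruct (Hc (2 * t) ltac:(lra) P HP) as [d Hd].
      assert (Hd2 : 0 < d / 2) by (destruct d; simpl; lra).
      exists (mkposreal _ Hd2). intros s Hs H01 H2. simpl in Hs.
      unfold concat_path. destruct (Rle_dec s (1 / 2)); [|lra].
      apply Hd; [|lra]. change (Rabs (2 * s - 2 * t) < d).
      replace (2 * s - 2 * t) with (2 * (s - t)) by ring.
      rewrite Rabs_mult, (Rabs_right 2) by lra. lra. }
    assert (Hr : 1 / 2 <= t -> exists d : posreal, forall s, Rabs (s - t) < d ->
       0 <= s <= 1 -> 1 / 2 < s -> P (concat_path c c' s)).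
    { intros Hle.
      assert (HP' : locally (c' (2 * t - 1)) P).
      { unfold concat_path in HP. destruct (Rle_dec t (1 / 2)); [|exact HP].
        replace (2 * t) with 1 in HP by lra. rewrite He in HP.
        replace (2 * t - 1) with 0 by lra. exact HP. }
      destruct (Hc' (2 * t - 1) ltac:(lra) P HP') as [d Hd].
      assert (Hd2 : 0 < d / 2) by (destruct d; simpl; lra).
      exists (mkposreal _ Hd2). intros s Hs H01 H2. simpl in Hs.
      unfold concat_path. destruct (Rle_dec s (1 / 2)); [lra|].
      apply Hd; [|lra]. change (Rabs (2 * s - 1 - (2 * t - 1)) < d).
      replace (2 * s - 1 - (2 * t - 1)) with (2 * (s - t)) by ring.
      rewrite Rabs_mult, (Rabs_right 2) by lra. lra. }
    destruct (Rtotal_order t (1 / 2)) as [H|[H|H]].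
    + destruct (Hl ltac:(lra)) as [d Hd].
      assert (Hm : 0 < Rmin d (1 / 2 - t)).
      { apply Rmin_pos; [apply cond_pos|lra]. }
      exists (mkposreal _ Hm). intros s Hs H01.
      change (Rabs (s - t) < Rmin d (1 / 2 - t)) in Hs.
      pose proof (Rmin_l d (1 / 2 - t)). pose proof (Rmin_r d (1 / 2 - t)).
      pose proof (Rle_abs (s - t)).
      apply Hd; [lra|exact H01|lra].
    + destruct (Hl ltac:(lra)) as [d Hd]. destruct (Hr ltac:(lra)) as [d' Hd'].
      assert (Hm : 0 < Rmin d d').
      { apply Rmin_pos; apply cond_pos. }
      exists (mkposreal _ Hm). intros s Hs H01.
      change (Rabs (s - t) < Rmin d d') in Hs.
      pose proof (Rmin_l d d'). pose proof (Rmin_r d d').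
      destruct (Rle_lt_dec s (1 / 2)).
      * apply Hd; [lra|exact H01|lra].
      * apply Hd'; [lra|exact H01|lra].
    + destruct (Hr ltac:(lra)) as [d Hd].
      assert (Hm : 0 < Rmin d (t - 1 / 2)).
      { apply Rmin_pos; [apply cond_pos|lra]. }
      exists (mkposreal _ Hm). intros s Hs H01.
      change (Rabs (s - t) < Rmin d (t - 1 / 2)) in Hs.
      pose proof (Rmin_l d (t - 1 / 2)). pose proof (Rmin_r d (t - 1 / 2)).
      rewrite Rabs_minus_sym in Hs. pose proof (Rle_abs (t - s)).
      apply Hd; [rewrite Rabs_minus_sym; lra|exact H01|lra].
  - intros t Ht. unfold unit_interval in *. unfold concat_path.
    destruct (Rle_dec t (1 / 2)); [apply HO|apply HO']; lra.
Qed.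

(** The first halving cuts exactly at the junction, which is why one level is lost. *)
Lemma dyadic_sum_concat J k c c' : c 1 = c' 0 ->
  dyadic_sum J (S k) (concat_path c c') 0 1
  = dyadic_sum J k c 0 1 + dyadic_sum J k c' 0 1.
Proof.
  intros He. simpl. replace ((0 + 1) / 2) with (1 / 2) by lra. f_equal.
  - rewrite (dyadic_sum_affine J k _ c 2 0); [f_equal; lra|lra|].
    intros t Ht. unfold concat_path. destruct (Rle_dec t (1 / 2)); [|lra].
    f_equal; lra.
  - rewrite (dyadic_sum_affine J k _ c' 2 (- 1)); [f_equal; lra|lra|].
    intros t Ht. unfold concat_path. destruct (Rle_dec t (1 / 2)).
    + replace (2 * t) with 1 by lra. rewrite He. f_equal; lra.
    + f_equal.
Qed.

Lemma reverse_path_in (Om : R * R -> Prop) c :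
  path_in Om c -> path_in Om (fun t => c (1 - t)).
Proof.
  intros [Hc HO]. split.
  - intros t Ht P HP.
    destruct (Hc (1 - t) ltac:(unfold unit_interval in *; lra) P HP) as [d Hd].
    exists d. intros s Hs H01. apply Hd; [|unfold unit_interval in *; lra].
    change (Rabs (1 - s - (1 - t)) < d). change (Rabs (s - t) < d) in Hs.
    replace (1 - s - (1 - t)) with (- (s - t)) by ring.
    rewrite Rabs_Ropp. exact Hs.
  - intros t Ht. apply HO. unfold unit_interval in *; lra.
Qed.

(** The path [c] followed by [c'] reversed is a loop, hence null-homotopic. Its sum is taken at
    level [S k] so that both halves have level [k]. *)
Lemma dyadic_sum_path_independent (Om : R * R -> Prop) J c c' :
  simply_connected Om -> (forall p, Om p -> additive_near J p) ->
  path_in Om c -> path_in Om c' -> c 0 = c' 0 -> c 1 = c' 1 ->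
  eventually (fun k => dyadic_sum J k c 0 1 = dyadic_sum J k c' 0 1).
Proof.
  intros [_ Hsc] HJ Hc Hc' H0 H1.
  set (r := fun t => c' (1 - t)).
  assert (Hr : path_in Om r) by (apply reverse_path_in; exact Hc').
  assert (E1 : c 1 = r 0).
  { unfold r. rewrite H1. f_equal; lra. }
  pose proof (concat_path_in Om c r Hc Hr E1) as Hl.
  assert (E : concat_path c r 0 = concat_path c r 1).
  { unfold concat_path. destruct (Rle_dec 0 (1 / 2)); [|lra].
    destruct (Rle_dec 1 (1 / 2)); [lra|]. unfold r.
    replace (2 * 0) with 0 by ring. rewrite H0. f_equal; lra. }
  destruct (dyadic_sum_null_homotopic Om J _ HJ Hl (Hsc _ Hl E)) as [k1 Hk1].
  destruct (dyadic_sum_reverse Om J c' HJ Hc') as [k2 Hk2].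
  exists (Nat.max k1 k2). intros k Hk.
  assert (Hk1' : (k1 <= S k)%nat).
  { apply Nat.le_trans with (Nat.max k1 k2); [apply Nat.le_max_l|].
    apply Nat.le_trans with k; [exact Hk|apply Nat.le_succ_diag_r]. }
  assert (Hk2' : (k2 <= k)%nat).
  { apply Nat.le_trans with (Nat.max k1 k2); [apply Nat.le_max_r|exact Hk]. }
  specialize (Hk1 _ Hk1'). specialize (Hk2 _ Hk2').
  rewrite dyadic_sum_concat in Hk1 by exact E1.
  rewrite (dyadic_sum_affine J k r c' (- 1) 1) in Hk1;
    [|lra|intros; unfold r; f_equal; lra].
  replace (-1 * 0 + 1) with 1 in Hk1 by ring.
  replace (-1 * 1 + 1) with 0 in Hk1 by ring. lra.
Qed.

Definition segment_path (q q' : R * R) (t : R) : R * R :=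
  (fst q + t * (fst q' - fst q), snd q + t * (snd q' - snd q)).

Lemma segment_path_ball (q q' : R * R) (e : posreal) t :
  ball q e q' -> 0 <= t <= 1 -> ball q e (segment_path q q' t).
Proof.
  intros [H1 H2] Ht.
  change (Rabs (fst q' - fst q) < e) in H1.
  change (Rabs (snd q' - snd q) < e) in H2.
  assert (Hs : forall x, Rabs x < e -> Rabs (t * x) < e).
  { intros x Hx. rewrite Rabs_mult, (Rabs_right t) by lra.
    pose proof (Rabs_pos x). nra. }
  split.
  - change (Rabs (fst q + t * (fst q' - fst q) - fst q) < e).
    replace (fst q + t * (fst q' - fst q) - fst q)
      with (t * (fst q' - fst q)) by ring. apply Hs, H1.
  - change (Rabs (snd q + t * (snd q' - snd q) - snd q) < e).
    replace (snd q + t * (snd q' - snd q) - snd q)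
      with (t * (snd q' - snd q)) by ring. apply Hs, H2.
Qed.

Lemma segment_path_continuous (q q' : R * R) D :
  continuous_on D (segment_path q q').
Proof.
  intros t _.
  assert (Hf : forall a b : R, continuous (fun s : R => a + s * b) t).
  { intros a b. apply (ex_derive_continuous (fun s : R => a + s * b)).
    auto_derive; trivial. }
  intros P [e HP].
  destruct (Hf (fst q) (fst q' - fst q) (ball (fst q + t * (fst q' - fst q)) e))
    as [d1 Hd1]; [exists e; auto|].
  destruct (Hf (snd q) (snd q' - snd q) (ball (snd q + t * (snd q' - snd q)) e))
    as [d2 Hd2]; [exists e; auto|].
  assert (Hm : 0 < Rmin d1 d2) by (apply Rmin_pos; apply cond_pos).
  exists (mkposreal _ Hm). intros s Hs _. apply HP.
  change (Rabs (s - t) < Rmin d1 d2) in Hs.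
  split; [apply Hd1|apply Hd2]; change (Rabs (s - t) < d1) ||
    change (Rabs (s - t) < d2); eapply Rlt_le_trans;
    [exact Hs|apply Rmin_l|exact Hs|apply Rmin_r].
Qed.

Lemma dyadic_sum_in_ball J k p (e : posreal) (c : R -> R * R) :
  (forall a b c, ball p e a -> ball p e b -> ball p e c ->
     J a b + J b c = J a c) ->
  forall a b, a <= b -> (forall t, a <= t <= b -> ball p e (c t)) ->
  dyadic_sum J k c a b = J (c a) (c b).
Proof.
  intros He. induction k as [|k IH]; intros a b Hab Hc; simpl; [reflexivity|].
  rewrite !IH; try lra; try (intros; apply Hc; lra).
  apply He; apply Hc; lra.
Qed.

(** The value at [q] is the eventual sum along any path from a base point to [q]. Prolonging such a
    path by a straight segment to a nearby [q'] adds exactly [J q q'], since the segment stays in a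
    ball where [J] is additive. *)
Theorem additive_potential (Om : R * R -> Prop) J :
  open Om -> simply_connected Om -> (forall p, Om p -> additive_near J p) ->
  exists F : R * R -> R, forall q, Om q ->
    locally q (fun q' => F q' = F q + J q q').
Proof.
  intros HO Hsc HJ.
  destruct (classic (exists q0, Om q0)) as [[q0 Hq0]|He].
  (* An empty [Om] has no base point. *)
  2: { exists (fun _ => 0). intros q Hq. destruct He; exists q; exact Hq. }
  set (Rel := fun q v => exists c, path_in Om c /\ c 0 = q0 /\ c 1 = q /\
    eventually (fun k => dyadic_sum J k c 0 1 = v)).
  exists (fun q => epsilon (inhabits 0) (Rel q)).
  assert (Hex : forall q, Om q -> exists v, Rel q v).
  { intros q Hq. destruct (proj1 Hsc q0 q Hq0 Hq) as (c & Hc & H0 & H1).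
    destruct (dyadic_sum_eventually_const Om J c HJ Hc) as [v Hv].
    exists v, c. auto. }
  assert (Huniq : forall q v v', Rel q v -> Rel q v' -> v = v').
  { intros q v v' (c & Hc & H0 & H1 & Hv) (c' & Hc' & H0' & H1' & Hv').
    (* Three eventual equalities are combined at a common level; the conclusion does not depend on
       that level. *)
    assert (E : eventually (fun _ : nat => v = v')).
    { pose proof (dyadic_sum_path_independent Om J c c' Hsc HJ Hc Hc'
        ltac:(congruence) ltac:(congruence)) as Hi.
      pose proof (filter_and _ _ (filter_and _ _ Hv Hv') Hi) as Ha.
      revert Ha. apply filter_imp. intros k [[Ha Hb] Hd]. congruence. }
    destruct E as [k Hk]. apply (Hk k), Nat.le_refl. }
  intros q Hq. destruct (HJ q Hq) as [e He]. destruct (HO q Hq) as [e' He'].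
  assert (Hm : 0 < Rmin e e') by (apply Rmin_pos; apply cond_pos).
  exists (mkposreal _ Hm). intros q' Hq'.
  assert (B : ball q e q') by (apply ball_le with (2 := Hq'), Rmin_l).
  assert (B' : ball q e' q') by (apply ball_le with (2 := Hq'), Rmin_r).
  assert (HR : Rel q (epsilon (inhabits 0) (Rel q)))
    by (apply epsilon_spec, Hex, Hq).
  apply (Huniq q').
  { apply epsilon_spec, Hex, He', B'. }
  destruct HR as (c & Hc & H0 & H1 & Hv).
  set (s := segment_path q q').
  assert (Hs : path_in Om s).
  { split; [apply segment_path_continuous|].
    intros t Ht. apply He', segment_path_ball; [exact B'|exact Ht]. }
  assert (s0 : s 0 = q).
  { unfold s, segment_path. destruct q; simpl. f_equal; ring. }
  assert (s1 : s 1 = q').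
  { unfold s, segment_path. destruct q, q'; simpl. f_equal; ring. }
  exists (concat_path c s).
  split; [apply concat_path_in; congruence|].
  split. { unfold concat_path. destruct (Rle_dec 0 (1 / 2)); [|lra].
    rewrite <- H0. f_equal; ring. }
  split. { unfold concat_path. destruct (Rle_dec 1 (1 / 2)); [lra|].
    rewrite <- s1. f_equal; ring. }
  (* Level 0 is excluded because a concatenation splits only from level 1 on. *)
  destruct Hv as [k0 Hk0]. exists (S k0). intros [|k] Hk; [inversion Hk|].
  rewrite dyadic_sum_concat by congruence.
  rewrite Hk0 by (apply le_S_n, Hk). f_equal.
  rewrite (dyadic_sum_in_ball J k q e s He); [congruence|lra|].
  intros t Ht. apply segment_path_ball; assumption.
Qed.

(** * Closed forms *)

Lemma continuity_2d_continuous_x f x y :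
  continuity_2d_pt f x y -> continuous (fun t => f t y) x.
Proof.
  intros H P [e HP]. destruct (H e) as [d Hd]. exists d. intros t Ht.
  apply HP, Hd; [exact Ht|]. rewrite Rminus_diag, Rabs_R0. apply cond_pos.
Qed.

Lemma continuity_2d_continuous_y f x y :
  continuity_2d_pt f x y -> continuous (fun t => f x t) y.
Proof.
  intros H P [e HP]. destruct (H e) as [d Hd]. exists d. intros t Ht.
  apply HP, Hd; [|exact Ht]. rewrite Rminus_diag, Rabs_R0. apply cond_pos.
Qed.

Lemma Rabs_between x0 e a b t :
  Rabs (a - x0) < e -> Rabs (b - x0) < e -> Rmin a b <= t <= Rmax a b ->
  Rabs (t - x0) < e.
Proof.
  intros Ha Hb. apply Rabs_lt_between in Ha, Hb. intros Ht.
  apply Rabs_lt_between. revert Ht.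
  unfold Rmin, Rmax. destruct (Rle_dec a b); intros; lra.
Qed.

Lemma locally_Rabs x0 e x :
  Rabs (x - x0) < e -> locally x (fun t : R => Rabs (t - x0) < e).
Proof.
  intros H. assert (Hd : 0 < e - Rabs (x - x0)) by lra.
  exists (mkposreal _ Hd). intros t Ht.
  change (Rabs (t - x) < e - Rabs (x - x0)) in Ht.
  replace (t - x0) with ((t - x) + (x - x0)) by ring.
  eapply Rle_lt_trans; [apply Rabs_triang|]. lra.
Qed.

Lemma is_derive_RInt_upper f x0 e a b :
  (forall t, Rabs (t - x0) < e -> continuous f t) ->
  Rabs (a - x0) < e -> Rabs (b - x0) < e ->
  is_derive (fun x : R => RInt (V := R_CompleteNormedModule) f a x) b (f b).
Proof.
  intros Hf Ha Hb.
  apply (is_derive_RInt f (fun x => RInt f a x) a b); [|apply Hf, Hb].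
  apply filter_imp with (2 := locally_Rabs _ _ _ Hb). intros t Ht.
  apply (RInt_correct (V := R_CompleteNormedModule) f),
    (ex_RInt_continuous (V := R_CompleteNormedModule)). intros z Hz.
  apply Hf, (Rabs_between x0 e a t); assumption.
Qed.

Lemma is_derive_0_eq (f : R -> R) x0 e a b :
  (forall t, Rabs (t - x0) < e -> is_derive f t 0) ->
  Rabs (a - x0) < e -> Rabs (b - x0) < e -> f a = f b.
Proof.
  intros Hf Ha Hb.
  destruct (MVT_gen f a b (fun _ => 0)) as (c & _ & Hc).
  - intros x Hx. apply Hf, (Rabs_between x0 e a b); lra.
  - intros x Hx. apply continuity_pt_filterlim.
    apply (ex_derive_continuous f). exists 0.
    apply Hf, (Rabs_between x0 e a b); assumption.
  - lra.
Qed.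

(** The integral of [P dx + Q dy] along the path that goes horizontally from [a], then vertically to
    [b]. Its corner lies in every ball that contains both ends, since balls are squares. *)
Definition L_integral (P Q : R -> R -> R) (a b : R * R) : R :=
  RInt (fun t => P t (snd a)) (fst a) (fst b)
  + RInt (fun t => Q (fst b) t) (snd a) (snd b).

Section Closed_form.

Variables (P Q : R -> R -> R) (x0 y0 : R) (e : posreal).

Definition in_box (x y : R) : Prop := Rabs (x - x0) < e /\ Rabs (y - y0) < e.

Hypothesis P_C1 : forall x y, in_box x y -> ex_diff_n P 1 x y.
Hypothesis Q_C1 : forall x y, in_box x y -> ex_diff_n Q 1 x y.
Hypothesis curl_free : forall x y, in_box x y -> pdy P x y = pdx Q x y.

Lemma L_integral_derive_y xa ya x y : in_box xa ya -> in_box x y ->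
  is_derive (fun t => L_integral P Q (xa, ya) (x, t)) y (Q x y).
Proof.
  intros [Ha1 Ha2] [Hb1 Hb2]. unfold L_integral; simpl.
  replace (Q x y) with (0 + Q x y) by ring.
  apply (is_derive_plus (fun _ : R => RInt (fun s => P s ya) xa x)
    (fun t : R => RInt (fun s => Q x s) ya t)).
  - apply (is_derive_const (K := R_AbsRing) (V := R_NormedModule)).
  - apply (is_derive_RInt_upper (fun s => Q x s) y0 e); try assumption.
    intros t Ht. apply continuity_2d_continuous_y, Q_C1. split; assumption.
Qed.

(** Differentiation under the vertical integral produces the integral of [Q_x]. Closedness turns the
    integrand into [P_y], whose integral is [P x y - P x ya], and this completes the term [P x ya]
    from the horizontal part. *)
Lemma L_integral_derive_x xa ya x y : in_box xa ya -> in_box x y ->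
  is_derive (fun t => L_integral P Q (xa, ya) (t, y)) x (P x y).
Proof.
  intros [Ha1 Ha2] [Hb1 Hb2]. unfold L_integral; simpl.
  replace (P x y)
    with (P x ya + RInt (fun t => Derive (fun u => Q u t) x) ya y).
  - apply (is_derive_plus (fun t : R => RInt (fun s => P s ya) xa t)
      (fun t : R => RInt (fun s => Q t s) ya y)).
    + apply (is_derive_RInt_upper (fun s => P s ya) x0 e); try assumption.
      intros t Ht. apply continuity_2d_continuous_x, P_C1. split; assumption.
    + apply (is_derive_RInt_param (fun u v => Q u v)).
      * apply filter_imp with (2 := locally_Rabs _ _ _ Hb1).
        intros u Hu t Ht. apply Q_C1. split; [exact Hu|].
        apply (Rabs_between y0 e ya y); assumption.
      * intros t Ht. apply Q_C1. split; [exact Hb1|].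
        apply (Rabs_between y0 e ya y); assumption.
      * apply filter_imp with (2 := locally_Rabs _ _ _ Hb1).
        intros u Hu. apply (ex_RInt_continuous (fun t => Q u t)).
        intros t Ht. apply continuity_2d_continuous_y, Q_C1.
        split; [exact Hu|]. apply (Rabs_between y0 e ya y); assumption.
  - assert (H : is_RInt (fun t => Derive (fun u => Q u t) x) ya y
                  (minus (P x y) (P x ya))).
    { apply (is_RInt_ext (fun t => pdy P x t)).
      { intros t Ht. apply curl_free. split; [exact Hb1|].
        apply (Rabs_between y0 e ya y); lra. }
      apply (is_RInt_derive (fun t => P x t)).
      - intros t Ht. apply Derive_correct, P_C1. split; [exact Hb1|].
        apply (Rabs_between y0 e ya y); assumption.
      - intros t Ht. apply (continuity_2d_continuous_y (pdy P)), P_C1.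
        split; [exact Hb1|]. apply (Rabs_between y0 e ya y); assumption. }
    rewrite (is_RInt_unique _ _ _ _ H). unfold minus, plus, opp; simpl. ring.
Qed.

(** As functions of the end point, the integrals from [a] and from [b] have the same gradient
    [(P, Q)], so their difference is constant on the box; its value at [b] is the integral from [a]
    to [b]. *)
Lemma L_integral_additive a b c :
  in_box (fst a) (snd a) -> in_box (fst b) (snd b) -> in_box (fst c) (snd c) ->
  L_integral P Q a b + L_integral P Q b c = L_integral P Q a c.
Proof.
  destruct a as [xa ya], b as [xb yb], c as [xc yc]; simpl. intros Ha Hb Hc.
  set (G := fun x y => L_integral P Q (xa, ya) (x, y)
                       - L_integral P Q (xb, yb) (x, y)).
  assert (E : G xb yb = G xc yc).
  (* From [b] to [c] through a corner of the box, one coordinate at a time. *)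
  { transitivity (G xb yc).
    - apply (is_derive_0_eq (fun t => G xb t) y0 e);
        try apply Hb; try apply Hc.
      intros t Ht. unfold G.
      replace 0 with (minus (Q xb t) (Q xb t)) by apply Rminus_diag.
      apply (is_derive_minus (K := R_AbsRing) (V := R_NormedModule));
        apply L_integral_derive_y; try assumption; split; try assumption;
        apply Hb.
    - apply (is_derive_0_eq (fun t => G t yc) x0 e);
        try apply Hb; try apply Hc.
      intros t Ht. unfold G.
      replace 0 with (minus (P t yc) (P t yc)) by apply Rminus_diag.
      apply (is_derive_minus (K := R_AbsRing) (V := R_NormedModule));
        apply L_integral_derive_x; try assumption; split; try assumption;
        apply Hc. }
  unfold G in E.
  replace (L_integral P Q (xb, yb) (xb, yb)) with 0 in E; [lra|].
  unfold L_integral; simpl. rewrite !RInt_point.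
  unfold zero; simpl. ring.
Qed.

End Closed_form.

(** Near a point [q] the potential is a constant plus the local increment from [q], so it inherits
    the partial derivatives of [L_integral]. *)
Theorem closed_form_exact (Om : R * R -> Prop) (P Q : R -> R -> R) :
  open Om -> simply_connected Om ->
  Ck_on 1 Om P -> Ck_on 1 Om Q ->
  (forall x y, Om (x, y) -> pdy P x y = pdx Q x y) ->
  exists F : R -> R -> R, forall x y, Om (x, y) ->
    is_derive (fun t => F t y) x (P x y) /\
    is_derive (fun t => F x t) y (Q x y).
Proof.
  intros HO Hsc HP HQ Hcl.
  destruct (additive_potential Om (L_integral P Q) HO Hsc) as [F HF].
  { intros [x0 y0] H. destruct (HO _ H) as [e He]. exists e.
    assert (Hin : forall x y, in_box x0 y0 e x y -> Om (x, y)).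
    { intros x y [Hx Hy]. apply He. split; assumption. }
    intros a b c Ha Hb Hc.
    apply (L_integral_additive P Q x0 y0 e); auto. }
  exists (fun x y => F (x, y)). intros x y Hxy.
  destruct (HO _ Hxy) as [e He].
  assert (Hc : in_box x y e x y).
  { split; rewrite Rminus_diag, Rabs_R0; apply cond_pos. }
  assert (Hin : forall u v, in_box x y e u v -> Om (u, v)).
  { intros u v [Hu Hv]. apply He. split; assumption. }
  destruct (HF _ Hxy) as [d Hd].
  split.
  - apply is_derive_ext_loc with
      (f := fun t => F (x, y) + L_integral P Q (x, y) (t, y)).
    { exists d. intros t Ht. symmetry. apply Hd. split; [exact Ht|].
      apply ball_center. }
    replace (P x y) with (0 + P x y) by ring.
    apply (is_derive_plus (fun _ : R => F (x, y))).
    + apply (is_derive_const (K := R_AbsRing) (V := R_NormedModule)).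
    + apply (L_integral_derive_x P Q x y e); auto.
  - apply is_derive_ext_loc with
      (f := fun t => F (x, y) + L_integral P Q (x, y) (x, t)).
    { exists d. intros t Ht. symmetry. apply Hd. split; [|exact Ht].
      apply ball_center. }
    replace (Q x y) with (0 + Q x y) by ring.
    apply (is_derive_plus (fun _ : R => F (x, y))).
    + apply (is_derive_const (K := R_AbsRing) (V := R_NormedModule)).
    + apply (L_integral_derive_y P Q x y e); auto.
Qed.

(** * The function C_sigma *)

Lemma C1_differentiable f x y :
  locally_2d (fun u v => ex_diff_n f 1 u v) x y ->
  differentiable_pt_lim f x y (pdx f x y) (pdy f x y).
Proof.
  intros H. apply filterdiff_differentiable_pt_lim.
  pose proof (locally_2d_singleton _ _ _ H) as H0.
  apply filterdiff_ext_lin with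
    (fun u : R * R => plus (scal (fst u) (pdx f x y)) (scal (snd u) (pdy f x y))).
  - apply (is_derive_filterdiff f x y (pdx f)).
    + apply locally_2d_locally in H. revert H. apply filter_imp.
      intros [u v] Huv; simpl in *. apply Derive_correct, Huv.
    + apply Derive_correct, H0.
    + apply (continuity_2d_pt_filterlim (pdx f)), H0.
  - intros u. reflexivity.
Qed.

Lemma continuity_2d_pt_comp f g h x y :
  continuity_2d_pt f (g x y) (h x y) ->
  continuity_2d_pt g x y -> continuity_2d_pt h x y ->
  continuity_2d_pt (fun u v => f (g u v) (h u v)) x y.
Proof.
  intros Hf Hg Hh eps. destruct (Hf eps) as [d Hd].
  generalize (locally_2d_and _ _ _ _ (Hg d) (Hh d)).
  apply locally_2d_impl, locally_2d_forall. intros u v [Hu Hv].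
  apply Hd; assumption.
Qed.

(** [Cfun sigma] is twice the moment of order 1. Differentiation brings out the inner factor [t] and
    raises the order by one, so this family is closed under it. *)
Definition moment (n : nat) (g : R -> R -> R) (x y : R) : R :=
  RInt (fun t => t ^ n * g (t * x) (t * y)) 0 1.

Lemma continuity_2d_pt_pow n x y : continuity_2d_pt (fun _ t => t ^ n) x y.
Proof.
  induction n as [|n IH]; simpl; [apply continuity_2d_pt_const|].
  apply continuity_2d_pt_mult; [apply continuity_2d_pt_id2|exact IH].
Qed.

Lemma moment_integrand_x n g y : (forall x y, continuity_2d_pt g x y) ->
  forall x t, continuity_2d_pt (fun u t => t ^ n * g (t * u) (t * y)) x t.
Proof.
  intros Hg x t. apply continuity_2d_pt_mult; [apply continuity_2d_pt_pow|].
  apply (continuity_2d_pt_comp g (fun u t => t * u) (fun u t => t * y)).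
  - apply Hg.
  - apply continuity_2d_pt_mult;
      [apply continuity_2d_pt_id2|apply continuity_2d_pt_id1].
  - apply continuity_2d_pt_mult;
      [apply continuity_2d_pt_id2|apply continuity_2d_pt_const].
Qed.

Lemma moment_integrand_y n g x : (forall x y, continuity_2d_pt g x y) ->
  forall y t, continuity_2d_pt (fun v t => t ^ n * g (t * x) (t * v)) y t.
Proof.
  intros Hg y t. apply continuity_2d_pt_mult; [apply continuity_2d_pt_pow|].
  apply (continuity_2d_pt_comp g (fun v t => t * x) (fun v t => t * v)).
  - apply Hg.
  - apply continuity_2d_pt_mult;
      [apply continuity_2d_pt_id2|apply continuity_2d_pt_const].
  - apply continuity_2d_pt_mult;
      [apply continuity_2d_pt_id2|apply continuity_2d_pt_id1].
Qed.

Lemma moment_correct n g x y : (forall x y, continuity_2d_pt g x y) ->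
  is_RInt (fun t => t ^ n * g (t * x) (t * y)) 0 1 (moment n g x y).
Proof.
  intros Hg. apply (RInt_correct (V := R_CompleteNormedModule)),
    (ex_RInt_continuous (V := R_CompleteNormedModule)).
  intros t _.
  apply (continuity_2d_continuous_y _ _ _ (moment_integrand_x n g y Hg x t)).
Qed.

Lemma moment_continuous n g : (forall x y, continuity_2d_pt g x y) ->
  forall x y, continuity_2d_pt (moment n g) x y.
Proof.
  intros Hg x y eps.
  (* The square of half-side [M] contains the segments from the origin to all points whose
     coordinates differ from those of [(x, y)] by at most 1; [g] is uniformly continuous on it. *)
  set (M := Rabs x + Rabs y + 1).
  (* The integral estimate is non-strict; halving [eps] restores strictness. *)
  assert (He : 0 < eps / 2) by (destruct eps; simpl; lra).
  destruct (uniform_continuity_2d g (- M) M (- M) M (fun x y _ _ => Hg x y)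
    (mkposreal _ He)) as [d Hd]. simpl in Hd.
  assert (Hm : 0 < Rmin d 1) by (apply Rmin_pos; [apply cond_pos|lra]).
  exists (mkposreal _ Hm). simpl. intros u v Hu Hv.
  pose proof (Rmin_l d 1). pose proof (Rmin_r d 1).
  pose proof (Rabs_pos x). pose proof (Rabs_pos y).
  assert (HuM : Rabs u <= Rabs x + 1).
  { replace u with ((u - x) + x) by ring.
    eapply Rle_trans; [apply Rabs_triang|]. lra. }
  assert (HvM : Rabs v <= Rabs y + 1).
  { replace v with ((v - y) + y) by ring.
    eapply Rle_trans; [apply Rabs_triang|]. lra. }
  assert (Hs : forall t z, 0 <= t <= 1 -> Rabs (t * z) <= Rabs z).
  { intros t z Ht. rewrite Rabs_mult, (Rabs_right t) by lra.
    pose proof (Rabs_pos z). nra. }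
  assert (HM : forall t z, 0 <= t <= 1 -> Rabs z <= M -> - M <= t * z <= M).
  { intros t z Ht Hz. apply Rabs_le_between.
    apply Rle_trans with (2 := Hz). apply Hs, Ht. }
  pose proof (is_RInt_minus _ _ _ _ _ _ (moment_correct n g u v Hg)
    (moment_correct n g x y Hg)) as Hi.
  change (minus (moment n g u v) (moment n g x y))
    with (moment n g u v - moment n g x y) in Hi.
  rewrite <- (is_RInt_unique _ _ _ _ Hi).
  apply Rle_lt_trans with ((1 - 0) * (eps / 2)); [|destruct eps; simpl in *; lra].
  apply abs_RInt_le_const; [lra|eexists; exact Hi|].
  intros t Ht. unfold minus, plus, opp; simpl.
  replace (t ^ n * g (t * u) (t * v) + - (t ^ n * g (t * x) (t * y)))
    with (t ^ n * (g (t * u) (t * v) - g (t * x) (t * y))) by ring.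
  assert (Hp : 0 <= t ^ n <= 1).
  { split; [apply pow_le; lra|].
    replace 1 with (1 ^ n) by apply pow1. apply pow_incr; lra. }
  assert (Hg' : Rabs (g (t * u) (t * v) - g (t * x) (t * y)) < eps / 2).
  { apply Hd; try (apply HM; [exact Ht|unfold M; lra]).
    - rewrite <- Rmult_minus_distr_l.
      apply Rle_lt_trans with (1 := Hs _ _ Ht). lra.
    - rewrite <- Rmult_minus_distr_l.
      apply Rle_lt_trans with (1 := Hs _ _ Ht). lra. }
  eapply Rle_trans; [apply Hs, Hp|]. lra.
Qed.

Lemma is_derive_RInt_unit (f f' : R -> R -> R) x :
  (forall u t, is_derive (fun u => f u t) u (f' u t)) ->
  (forall u t, continuity_2d_pt f u t) ->
  (forall u t, continuity_2d_pt f' u t) ->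
  is_derive (fun u => RInt (fun t => f u t) 0 1) x (RInt (fun t => f' x t) 0 1).
Proof.
  intros Hd Hf Hf'.
  assert (E : forall u t, Derive (fun u => f u t) u = f' u t).
  { intros u t. apply is_derive_unique, Hd. }
  rewrite <- (RInt_ext (fun t => Derive (fun u => f u t) x))
    by (intros; apply E).
  apply (is_derive_RInt_param f).
  - apply filter_forall. intros u t _. eexists; apply Hd.
  - intros t _. apply continuity_2d_pt_ext with f'; [|apply Hf'].
    intros; symmetry; apply E.
  - apply filter_forall. intros u.
    apply (ex_RInt_continuous (V := R_CompleteNormedModule)).
    intros t _. apply (continuity_2d_continuous_y f), Hf.
Qed.

Lemma moment_derive_x n g x y :
  (forall x y, ex_diff_n g 1 x y) ->
  is_derive (fun u => moment n g u y) x (moment (S n) (pdx g) x y).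
Proof.
  intros Hg. apply (is_derive_RInt_unit
    (fun u t => t ^ n * g (t * u) (t * y))
    (fun u t => t ^ S n * pdx g (t * u) (t * y))).
  - intros u t.
    pose proof (Derive_correct _ _ (proj1 (proj2 (Hg (t * u) (t * y))))) as H.
    evar_last.
    + apply is_derive_scal.
      apply (is_derive_comp (fun z => g z (t * y)) (fun u => t * u)).
      * exact H.
      * apply is_derive_scal, is_derive_id.
    + unfold scal, one; simpl. unfold mult, pdx; simpl. ring.
  - intros u t. apply (moment_integrand_x n g y). intros; apply Hg.
  - intros u t. apply (moment_integrand_x (S n) (pdx g) y). intros; apply Hg.
Qed.

Lemma moment_derive_y n g x y :
  (forall x y, ex_diff_n g 1 x y) ->
  is_derive (fun v => moment n g x v) y (moment (S n) (pdy g) x y).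
Proof.
  intros Hg. apply (is_derive_RInt_unit
    (fun v t => t ^ n * g (t * x) (t * v))
    (fun v t => t ^ S n * pdy g (t * x) (t * v))).
  - intros v t.
    pose proof (Derive_correct _ _
      (proj1 (proj2 (proj2 (Hg (t * x) (t * v)))))) as H.
    evar_last.
    + apply is_derive_scal.
      apply (is_derive_comp (fun z => g (t * x) z) (fun v => t * v)).
      * exact H.
      * apply is_derive_scal, is_derive_id.
    + unfold scal, one; simpl. unfold mult, pdy; simpl. ring.
  - intros u t. apply (moment_integrand_y n g x). intros; apply Hg.
  - intros u t. apply (moment_integrand_y (S n) (pdy g) x). intros; apply Hg.
Qed.

(* The integrand is the [t]-derivative of [t ^ 2 * sigma (t * x) (t * y)]. *)
Lemma moment_euler sigma x y :
  (forall x y, ex_diff_n sigma 1 x y) ->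
  2 * moment 1 sigma x y + x * moment 2 (pdx sigma) x y
  + y * moment 2 (pdy sigma) x y = sigma x y.
Proof.
  intros Hs.
  set (df := fun t => 2 * (t ^ 1 * sigma (t * x) (t * y))
    + x * (t ^ 2 * pdx sigma (t * x) (t * y))
    + y * (t ^ 2 * pdy sigma (t * x) (t * y))).
  assert (H1 : is_RInt df 0 1 (2 * moment 1 sigma x y
    + x * moment 2 (pdx sigma) x y + y * moment 2 (pdy sigma) x y)).
  { apply (is_RInt_plus (V := R_NormedModule));
      [apply (is_RInt_plus (V := R_NormedModule))|];
      apply (is_RInt_scal (V := R_NormedModule)), moment_correct;
      intros; apply Hs. }
  assert (Hc : forall (g : R -> R -> R) n t,
    (forall x y, continuity_2d_pt g x y) ->
    continuous (fun t => t ^ n * g (t * x) (t * y)) t).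
  { intros g n t Hg.
    apply (continuity_2d_continuous_y _ _ _ (moment_integrand_x n g y Hg x t)). }
  assert (H2 : is_RInt df 0 1
    (minus (1 ^ 2 * sigma (1 * x) (1 * y)) (0 ^ 2 * sigma (0 * x) (0 * y)))).
  { apply (is_RInt_derive (fun t => t ^ 2 * sigma (t * x) (t * y))).
    - intros t _.
      assert (Hd : is_derive (fun t => sigma (t * x) (t * y)) t
        (pdx sigma (t * x) (t * y) * x + pdy sigma (t * x) (t * y) * y)).
      { apply is_derive_Reals.
        apply (derivable_pt_lim_comp_2d sigma (fun t => t * x) (fun t => t * y)).
        - apply C1_differentiable, locally_2d_forall. exact Hs.
        - apply is_derive_Reals. auto_derive; [trivial|ring].
        - apply is_derive_Reals. auto_derive; [trivial|ring]. }
      evar_last.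
      + apply (is_derive_mult (fun t => t ^ 2)); [|exact Hd|intros; apply Rmult_comm].
        apply is_derive_pow, is_derive_id.
      + unfold df, plus, mult, one; simpl. ring.
    - intros t _.
      apply (continuous_plus (V := R_NormedModule));
        [apply (continuous_plus (V := R_NormedModule))|];
        apply (continuous_scal_r (V := R_NormedModule)), Hc; intros; apply Hs. }
  apply (is_RInt_unique (V := R_CompleteNormedModule)) in H1, H2.
  rewrite <- H1, H2. unfold minus, plus, opp; simpl.
  rewrite !Rmult_1_l. ring.
Qed.

Lemma Cfun_moment sigma x y : Cfun sigma x y = 2 * moment 1 sigma x y.
Proof.
  unfold Cfun, moment. f_equal. apply RInt_ext. intros t _. rewrite pow_1.
  reflexivity.
Qed.

Lemma Cfun_derive_x sigma x y : (forall x y, ex_diff_n sigma 1 x y) ->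
  is_derive (fun t => Cfun sigma t y) x (2 * moment 2 (pdx sigma) x y).
Proof.
  intros Hs. apply is_derive_ext with (fun t => 2 * moment 1 sigma t y).
  { intros t. symmetry. apply Cfun_moment. }
  apply is_derive_scal, moment_derive_x, Hs.
Qed.

Lemma Cfun_derive_y sigma x y : (forall x y, ex_diff_n sigma 1 x y) ->
  is_derive (fun t => Cfun sigma x t) y (2 * moment 2 (pdy sigma) x y).
Proof.
  intros Hs. apply is_derive_ext with (fun t => 2 * moment 1 sigma x t).
  { intros t. symmetry. apply Cfun_moment. }
  apply is_derive_scal, moment_derive_y, Hs.
Qed.

Lemma Cfun_C1 sigma x y : (forall x y, ex_diff_n sigma 1 x y) ->
  ex_diff_n (Cfun sigma) 1 x y.
Proof.
  intros Hs. simpl. repeat split; try trivial.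
  - apply continuity_2d_pt_ext with (fun x y => 2 * moment 1 sigma x y).
    { intros; symmetry; apply Cfun_moment. }
    apply continuity_2d_pt_mult; [apply continuity_2d_pt_const|].
    apply moment_continuous. intros; apply Hs.
  - eexists; apply Cfun_derive_x, Hs.
  - eexists; apply Cfun_derive_y, Hs.
  - apply continuity_2d_pt_ext with (fun x y => 2 * moment 2 (pdx sigma) x y).
    { intros; symmetry. apply is_derive_unique, Cfun_derive_x, Hs. }
    apply continuity_2d_pt_mult; [apply continuity_2d_pt_const|].
    apply moment_continuous. intros; apply Hs.
  - apply continuity_2d_pt_ext with (fun x y => 2 * moment 2 (pdy sigma) x y).
    { intros; symmetry. apply is_derive_unique, Cfun_derive_y, Hs. }
    apply continuity_2d_pt_mult; [apply continuity_2d_pt_const|].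
    apply moment_continuous. intros; apply Hs.
Qed.

(** Equivalently, the 1-form [C_sigma (y dx - x dy)] has differential [- 2 sigma dx dy]: this is
    what makes [sigma] the bundle curvature, and the reason for the integral that defines [Cfun]. *)
Lemma Cfun_euler sigma x y : (forall x y, ex_diff_n sigma 1 x y) ->
  2 * Cfun sigma x y + x * pdx (Cfun sigma) x y + y * pdy (Cfun sigma) x y
  = 2 * sigma x y.
Proof.
  intros Hs. rewrite <- (moment_euler sigma x y Hs) at 1.
  replace (pdx (Cfun sigma) x y) with (2 * moment 2 (pdx sigma) x y)
    by (symmetry; apply is_derive_unique, Cfun_derive_x, Hs).
  replace (pdy (Cfun sigma) x y) with (2 * moment 2 (pdy sigma) x y)
    by (symmetry; apply is_derive_unique, Cfun_derive_y, Hs).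
  rewrite Cfun_moment. ring.
Qed.

(** * Mean curvature of graphs *)

(** The slopes are the values of [bundle_form] on [graph_X] and [graph_Y], that is, the vertical
    components of the tangent basis relative to the horizontal planes of the bundle. *)
Definition slope_x (eps : R) (sigma u : R -> R -> R) (x y : R) : R :=
  pdx u x y + eps * (y * Cfun sigma x y).

Definition slope_y (eps : R) (sigma u : R -> R -> R) (x y : R) : R :=
  pdy u x y - eps * (x * Cfun sigma x y).

(** The determinant of the first fundamental form of a graph with slopes [a], [b]. *)
Definition area2 (eps a b : R) : R := 1 + eps * (a ^ 2 + b ^ 2).

(* Expanded form of [d/dx (a / w) + d/dy (b / w)] for [w = sqrt (area2 eps a b)],
   where [ax], [by] are the derivatives of [a], [b] in [x], [y], and
   [s = da/dy + db/dx]. *)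
Definition flux_divergence (eps a b ax s by_ : R) : R :=
  ((1 + eps * b ^ 2) * ax - eps * (a * b) * s + (1 + eps * a ^ 2) * by_)
  / sqrt (area2 eps a b) ^ 3.

Definition bundle_form_derive (eps : R) (sigma : R -> R -> R) (x y : R)
    (d v : vec3) : R :=
  eps * ((pdx (Cfun sigma) x y * cx d + pdy (Cfun sigma) x y * cy d)
         * (y * cx v - x * cy v)
         + Cfun sigma x y * (cy d * cx v - cx d * cy v)).

Lemma is_derive_bundle_form eps sigma x y z (d v : vec3) :
  (forall x y, ex_diff_n sigma 1 x y) ->
  is_derive
    (fun t : R => bundle_form eps sigma (plus ((x, y, z) : vec3) (scal t d)) v) 0
    (bundle_form_derive eps sigma x y d v).
Proof.
  intros Hs. destruct d as [[dx dy] dz], v as [[vx vy] vz].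
  change (is_derive (fun t : R => vz + eps * Cfun sigma (x + t * dx) (y + t * dy)
    * ((y + t * dy) * vx - (x + t * dx) * vy)) 0
    (eps * ((pdx (Cfun sigma) x y * dx + pdy (Cfun sigma) x y * dy)
         * (y * vx - x * vy) + Cfun sigma x y * (dy * vx - dx * vy)))).
  assert (Hd : is_derive (fun t : R => Cfun sigma (x + t * dx) (y + t * dy)) 0
    (pdx (Cfun sigma) x y * dx + pdy (Cfun sigma) x y * dy)).
  { apply is_derive_Reals.
    apply (derivable_pt_lim_comp_2d (Cfun sigma) (fun t => x + t * dx)
      (fun t => y + t * dy)).
    - rewrite !Rmult_0_l, !Rplus_0_r.
      apply C1_differentiable, locally_2d_forall.
      intros; apply Cfun_C1, Hs.
    - apply is_derive_Reals. auto_derive; [trivial|ring].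
    - apply is_derive_Reals. auto_derive; [trivial|ring]. }
  (* Named so that [auto_derive] treats it as an atom, whose derivative is given by [Hd]. *)
  set (c := fun t : R => Cfun sigma (x + t * dx) (y + t * dy)) in *.
  change (is_derive (fun t : R => vz + eps * c t
    * ((y + t * dy) * vx - (x + t * dx) * vy)) 0
    (eps * ((pdx (Cfun sigma) x y * dx + pdy (Cfun sigma) x y * dy)
         * (y * vx - x * vy) + Cfun sigma x y * (dy * vx - dx * vy)))).
  assert (Hc0 : c 0 = Cfun sigma x y).
  { unfold c. f_equal; ring. }
  rewrite <- Hc0. rewrite <- (is_derive_unique _ _ _ Hd).
  auto_derive; [eexists; exact Hd|].
  rewrite Rmult_0_l. change (Derive (fun t : R => c t) 0) with (Derive c 0).
  ring.
Qed.

Lemma dir_derive_metric eps sigma x y z (d v w : vec3) :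
  (forall x y, ex_diff_n sigma 1 x y) ->
  dir_derive (fun q => bundle_metric eps sigma q v w) (x, y, z) d
  = eps * (bundle_form_derive eps sigma x y d v
           * bundle_form eps sigma (x, y, z) w
           + bundle_form eps sigma (x, y, z) v
             * bundle_form_derive eps sigma x y d w).
Proof.
  intros Hs. unfold dir_derive, bundle_metric. apply is_derive_unique.
  pose proof (is_derive_bundle_form eps sigma x y z d v Hs) as Hv.
  pose proof (is_derive_bundle_form eps sigma x y z d w Hs) as Hw.
  assert (E : forall v, bundle_form eps sigma (x, y, z) v
    = bundle_form eps sigma (plus ((x, y, z) : vec3) (scal 0 d)) v).
  { intros v'. f_equal. destruct d as [[dx dy] dz].
    change ((x, y, z) = (x + 0 * dx, y + 0 * dy, z + 0 * dz)).
    repeat f_equal; ring. }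
  rewrite !E.
  set (fv := fun t : R =>
    bundle_form eps sigma (plus ((x, y, z) : vec3) (scal t d)) v) in *.
  set (fw := fun t : R =>
    bundle_form eps sigma (plus ((x, y, z) : vec3) (scal t d)) w) in *.
  change (is_derive
   (fun t : R => cx v * cx w + cy v * cy w + eps * (fv t * fw t)) 0
   (eps * (bundle_form_derive eps sigma x y d v * fw 0
       + fv 0 * bundle_form_derive eps sigma x y d w))).
  evar_last.
  - apply (is_derive_plus (fun _ : R => cx v * cx w + cy v * cy w)).
    + apply (is_derive_const (K := R_AbsRing) (V := R_NormedModule)).
    + apply is_derive_scal, (is_derive_mult fv fw); [exact Hv|exact Hw|].
      intros; apply Rmult_comm.
  - unfold plus, mult, zero; simpl. ring.
Qed.

(** Write [n3] for the [bundle_form] of [N]. Orthogonality gives [cx N = - eps a n3] and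
    [cy N = - eps b n3]; the normalisation then reads [(n3 w)^2 = 1], and the upward condition
    [n3 w^2 > 0] selects the sign. *)
Lemma upward_unit_normal_iff eps sigma u x y (N : vec3) :
  eps * eps = 1 ->
  let a := slope_x eps sigma u x y in
  let b := slope_y eps sigma u x y in
  let w := sqrt (area2 eps a b) in
  0 < area2 eps a b ->
  upward_unit_normal eps (bundle_metric eps sigma) u x y N <->
  cx N = - (eps * a) / w /\ cy N = - (eps * b) / w /\
  bundle_form eps sigma (graph_pt u x y) N = 1 / w.
Proof.
  intros He a b w Hw.
  assert (Hw0 : 0 < w) by (apply sqrt_lt_R0, Hw).
  assert (Hww : w * w = 1 + eps * (a * a + b * b)).
  { unfold w. rewrite sqrt_sqrt by lra. unfold area2. ring. }
  set (n3 := bundle_form eps sigma (graph_pt u x y) N).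
  unfold upward_unit_normal, bundle_metric. fold n3.
  replace (bundle_form eps sigma (graph_pt u x y) (graph_X u x y)) with a
    by (unfold a, slope_x, bundle_form, graph_pt, graph_X, cx, cy, cz; simpl; ring).
  replace (bundle_form eps sigma (graph_pt u x y) (graph_Y u x y)) with b
    by (unfold b, slope_y, bundle_form, graph_pt, graph_Y, cx, cy, cz; simpl; ring).
  assert (Hup : cz N - pdx u x y * cx N - pdy u x y * cy N
                = n3 - a * cx N - b * cy N).
  { unfold n3, a, b, slope_x, slope_y, bundle_form, graph_pt, cx, cy, cz; simpl.
    ring. }
  rewrite Hup. clear Hup. clearbody n3 w. clearbody a b.
  (* [field] and [ring] do not reduce powers of [eps], so such identities are checked for each
     sign. *)
  assert (He' : eps = 1 \/ eps = - 1).
  { destruct (Rmult_integral (eps - 1) (eps + 1)); [lra|left|right]; lra. }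
  unfold graph_X, graph_Y. unfold cx at 2, cy at 2, cx at 3, cy at 3. simpl.
  split.
  - intros (HX & HY & HN & Hpos).
    assert (H1 : cx N = - (eps * a) * n3) by lra.
    assert (H2 : cy N = - (eps * b) * n3) by lra.
    rewrite H1, H2 in *.
    assert (H3 : (n3 * w) * (n3 * w) = 1).
    { replace (n3 * w * (n3 * w)) with (n3 * n3 * (w * w)) by ring.
      rewrite Hww. clear - He' HN. destruct He' as [-> | ->]; lra. }
    assert (H4 : 0 < n3 * (w * w)).
    { rewrite Hww. replace (n3 * (1 + eps * (a * a + b * b)))
        with (n3 - a * (- (eps * a) * n3) - b * (- (eps * b) * n3)) by ring.
      exact Hpos. }
    assert (H5 : n3 * w = 1) by nra.
    assert (H6 : n3 = 1 / w) by (field_simplify_eq; lra).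
    rewrite H6. repeat split; field; lra.
  - intros (H1 & H2 & H3). rewrite H1, H2, H3.
    repeat split.
    + field; lra.
    + field; lra.
    + apply Rmult_eq_reg_r with (w * w); [|nra].
      transitivity (eps * eps * (a * a + b * b) + eps); [field; lra|].
      rewrite Hww. clear - He'. destruct He' as [-> | ->]; ring.
    + replace (1 / w - a * (- (eps * a) / w) - b * (- (eps * b) / w))
        with ((1 + eps * (a * a + b * b)) / w) by (field; lra).
      rewrite <- Hww. apply Rdiv_lt_0_compat; nra.
Qed.

Lemma bundle_mean_curvature_quotient eps sigma u x y uxx uxy uyy (N : vec3) :
  (forall x y, ex_diff_n sigma 1 x y) ->
  eps * eps = 1 ->
  let g := bundle_metric eps sigma in
  let a := slope_x eps sigma u x y in
  let b := slope_y eps sigma u x y in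
  0 < area2 eps a b ->
  upward_unit_normal eps g u x y N ->
  let p := graph_pt u x y in
  let X := graph_X u x y in
  let Y := graph_Y u x y in
  let I11 := g p X X in
  let I12 := g p X Y in
  let I22 := g p Y Y in
  let L11 := g p (0, 0, uxx) N + christoffel g p X X N in
  let L12 := g p (0, 0, uxy) N + christoffel g p X Y N in
  let L22 := g p (0, 0, uyy) N + christoffel g p Y Y N in
  2 * (eps * (L11 * I22 - 2 * L12 * I12 + L22 * I11)
       / (2 * (I11 * I22 - I12 * I12)))
  = flux_divergence eps a b
      (uxx + eps * (y * pdx (Cfun sigma) x y))
      (2 * uxy + eps * (y * pdy (Cfun sigma) x y - x * pdx (Cfun sigma) x y))
      (uyy - eps * (x * pdy (Cfun sigma) x y)).
Proof.
  intros Hs He g a b Hw HN p X Y I11 I12 I22 L11 L12 L22.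
  apply upward_unit_normal_iff in HN; [|exact He|exact Hw].
  fold a b in HN. destruct HN as (H1 & H2 & H3).
  unfold flux_divergence. set (w := sqrt (area2 eps a b)) in *.
  assert (Hw0 : 0 < w) by (apply sqrt_lt_R0, Hw).
  assert (Hww : w * w = 1 + eps * (a * a + b * b)).
  { unfold w. rewrite sqrt_sqrt by lra. unfold area2. ring. }
  set (Cx := pdx (Cfun sigma) x y). set (Cy := pdy (Cfun sigma) x y).
  set (c := Cfun sigma x y).
  assert (HX : bundle_form eps sigma p X = a).
  { unfold a, slope_x, bundle_form, p, X, graph_pt, graph_X, cx, cy, cz; simpl.
    ring. }
  assert (HY : bundle_form eps sigma p Y = b).
  { unfold b, slope_y, bundle_form, p, Y, graph_pt, graph_Y, cx, cy, cz; simpl.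
    ring. }
  assert (HD : forall d v, bundle_form_derive eps sigma x y d v
    = eps * ((Cx * cx d + Cy * cy d) * (y * cx v - x * cy v)
             + c * (cy d * cx v - cx d * cy v))) by reflexivity.
  assert (HI11 : I11 = 1 + eps * (a * a)).
  { unfold I11, g, bundle_metric. rewrite HX.
    unfold X, graph_X, cx, cy; simpl. ring. }
  assert (HI12 : I12 = eps * (a * b)).
  { unfold I12, g, bundle_metric. rewrite HX, HY.
    unfold X, Y, graph_X, graph_Y, cx, cy; simpl. ring. }
  assert (HI22 : I22 = 1 + eps * (b * b)).
  { unfold I22, g, bundle_metric. rewrite HY.
    unfold Y, graph_Y, cx, cy; simpl. ring. }
  (* By the Euler identity [k] is [2 sigma]. It enters the second fundamental form through [a b k],
     [(b^2 - a^2) k / 2] and [- a b k], a part with zero trace relative to the first form, so it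
     disappears from the quotient. *)
  set (k := 2 * c + x * Cx + y * Cy).
  assert (Hvert : forall z, g p (0, 0, z) N = eps * z / w).
  { intros z. unfold g, bundle_metric, p. rewrite H3.
    unfold bundle_form, cx, cy, cz; simpl. field; lra. }
  assert (HCh : forall v v', christoffel g p v v' N
    = (eps * (bundle_form_derive eps sigma x y v v' * (1 / w)
           + bundle_form eps sigma p v' * bundle_form_derive eps sigma x y v N)
       + eps * (bundle_form_derive eps sigma x y v' v * (1 / w)
           + bundle_form eps sigma p v * bundle_form_derive eps sigma x y v' N)
       - eps * (bundle_form_derive eps sigma x y N v * bundle_form eps sigma p v'
           + bundle_form eps sigma p v * bundle_form_derive eps sigma x y N v'))
      / 2).
  { intros v v'. unfold christoffel, g, p, graph_pt.
    rewrite !dir_derive_metric by exact Hs.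
    unfold p, graph_pt in H3. unfold graph_pt in H3. rewrite H3. reflexivity. }
  assert (HcX : cx X = 1 /\ cy X = 0) by (split; reflexivity).
  assert (HcY : cx Y = 0 /\ cy Y = 1) by (split; reflexivity).
  destruct HcX as [HcX HcX'], HcY as [HcY HcY'].
  assert (He' : eps = 1 \/ eps = - 1).
  { destruct (Rmult_integral (eps - 1) (eps + 1)); [lra|left|right]; lra. }
  assert (HL11 : L11 = eps / w * (uxx + eps * (y * Cx) + a * b * k)).
  { unfold L11. rewrite Hvert, HCh, !HD, HX, H1, H2, HcX, HcX'. unfold k.
    clearbody a b w. destruct He' as [-> | ->]; field; lra. }
  assert (HL12 : L12 = eps / w * (uxy + eps * (y * Cy - x * Cx) / 2
                                  + (b * b - a * a) * k / 2)).
  { unfold L12. rewrite Hvert, HCh, !HD, HX, HY, H1, H2, HcX, HcX', HcY, HcY'.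
    unfold k. clearbody a b w. destruct He' as [-> | ->]; field; lra. }
  assert (HL22 : L22 = eps / w * (uyy - eps * (x * Cy) - a * b * k)).
  { unfold L22. rewrite Hvert, HCh, !HD, HY, H1, H2, HcY, HcY'. unfold k.
    clearbody a b w. destruct He' as [-> | ->]; field; lra. }
  rewrite HI11, HI12, HI22, HL11, HL12, HL22.
  replace (2 * ((1 + eps * (a * a)) * (1 + eps * (b * b))
                - eps * (a * b) * (eps * (a * b)))) with (2 * (w * w))
    by (rewrite Hww; ring).
  clearbody a b w k Cx Cy. clear - He' Hw0.
  destruct He' as [-> | ->]; field; lra.
Qed.

Lemma has_mean_curvature_iff eps sigma u x y h :
  (forall x y, ex_diff_n sigma 1 x y) ->
  eps * eps = 1 ->
  let a := slope_x eps sigma u x y in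
  let b := slope_y eps sigma u x y in
  0 < area2 eps a b ->
  has_mean_curvature eps (bundle_metric eps sigma) u x y h <->
  2 * h = flux_divergence eps a b
    (pdx (pdx u) x y + eps * (y * pdx (Cfun sigma) x y))
    (2 * pdy (pdx u) x y
     + eps * (y * pdy (Cfun sigma) x y - x * pdx (Cfun sigma) x y))
    (pdy (pdy u) x y - eps * (x * pdy (Cfun sigma) x y)).
Proof.
  intros Hs He a b Hw.
  pose proof (fun N => bundle_mean_curvature_quotient eps sigma u x y
    (pdx (pdx u) x y) (pdy (pdx u) x y) (pdy (pdy u) x y) N Hs He Hw) as Q.
  cbv zeta in Q. unfold has_mean_curvature. cbv zeta. split.
  - intros (N & HN & ->). apply Q, HN.
  - intros Hh.
    set (w := sqrt (area2 eps a b)).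
    set (n1 := - (eps * a) / w). set (n2 := - (eps * b) / w).
    (* The last coordinate is chosen so that the [bundle_form] of [N] is [1 / w]. *)
    set (N := (n1, n2, 1 / w - eps * Cfun sigma x y * (y * n1 - x * n2)) : vec3).
    assert (HN : upward_unit_normal eps (bundle_metric eps sigma) u x y N).
    { apply upward_unit_normal_iff; [exact He|exact Hw|].
      repeat split. unfold bundle_form, N, graph_pt, cx, cy, cz; simpl.
      fold a b w. ring. }
    exists N. split; [exact HN|].
    apply Rmult_eq_reg_l with 2; [|lra]. rewrite Hh. symmetry. exact (Q N HN).
Qed.

(** * Twin graphs *)

(** Being of class C^1 with named partial derivatives: sums, products and quotients then carry
    explicit formulas instead of nested [Derive] terms. *)
Definition has_C0_gradient (Om : R * R -> Prop) (f fx fy : R -> R -> R) : Prop :=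
  forall x y, Om (x, y) ->
    continuity_2d_pt f x y /\
    is_derive (fun t => f t y) x (fx x y) /\
    is_derive (fun t => f x t) y (fy x y) /\
    continuity_2d_pt fx x y /\ continuity_2d_pt fy x y.

Ltac split_gradient := refine (conj _ (conj _ (conj _ (conj _ _)))).

Lemma open_locally_2d (Om : R * R -> Prop) x y :
  open Om -> Om (x, y) -> locally_2d (fun u v => Om (u, v)) x y.
Proof.
  intros HO H. apply locally_2d_locally.
  apply filter_imp with (2 := HO _ H). intros [u v] Huv. exact Huv.
Qed.

Lemma Ck_1_gradient Om f : Ck_on 1 Om f -> has_C0_gradient Om f (pdx f) (pdy f).
Proof.
  intros Hf x y H. destruct (Hf x y H) as (H0 & H1 & H2 & [H3 _] & [H4 _]).
  split_gradient; try assumption; apply Derive_correct; assumption.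
Qed.

Lemma gradient_pd Om f fx fy x y : has_C0_gradient Om f fx fy -> Om (x, y) ->
  pdx f x y = fx x y /\ pdy f x y = fy x y.
Proof.
  intros Hf H. destruct (Hf x y H) as (_ & H1 & H2 & _).
  split; apply is_derive_unique; assumption.
Qed.

(** Equality on the open set [Om] is equality near each of its points. This gives second derivatives
    of a function whose first derivatives are known only on [Om]. *)
Lemma gradient_pd2 Om f g gx gy x y : open Om ->
  (forall x y, Om (x, y) -> f x y = g x y) -> has_C0_gradient Om g gx gy ->
  Om (x, y) -> pdx f x y = gx x y /\ pdy f x y = gy x y.
Proof.
  intros HO E Hg H. destruct (gradient_pd Om g gx gy x y Hg H) as [<- <-].
  assert (El : locally_2d (fun u v => f u v = g u v) x y).
  { generalize (open_locally_2d Om x y HO H).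
    apply locally_2d_impl, locally_2d_forall. exact E. }
  split; apply Derive_ext_loc.
  - exact (locally_2d_1d_const_y _ _ _ El).
  - exact (locally_2d_1d_const_x _ _ _ El).
Qed.

Lemma gradient_Ck_S k Om f fx fy : open Om -> has_C0_gradient Om f fx fy ->
  Ck_on k Om fx -> Ck_on k Om fy -> Ck_on (S k) Om f.
Proof.
  intros HO Hf Hx Hy x y H. destruct (Hf x y H) as (H0 & H1 & H2 & _).
  split; [exact H0|]. split; [eexists; exact H1|]. split; [eexists; exact H2|].
  split.
  - apply ex_diff_n_ext_loc with fx; [|apply Hx, H].
    generalize (open_locally_2d Om x y HO H).
    apply locally_2d_impl, locally_2d_forall. intros u v Huv.
    symmetry. apply (gradient_pd Om f fx fy u v Hf Huv).
  - apply ex_diff_n_ext_loc with fy; [|apply Hy, H].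
    generalize (open_locally_2d Om x y HO H).
    apply locally_2d_impl, locally_2d_forall. intros u v Huv.
    symmetry. apply (gradient_pd Om f fx fy u v Hf Huv).
Qed.

Lemma gradient_Ck_1 Om f fx fy : open Om -> has_C0_gradient Om f fx fy ->
  Ck_on 1 Om f.
Proof.
  intros HO Hf. apply (gradient_Ck_S 0 Om f fx fy HO Hf);
    intros x y H; split; try apply I; apply (Hf x y H).
Qed.

(** The clause not given is the continuity of [f]; it follows from differentiability, which the
    continuity of a partial derivative ensures. *)
Lemma gradient_of_derivatives Om f fx fy : open Om ->
  (forall x y, Om (x, y) -> is_derive (fun t => f t y) x (fx x y) /\
     is_derive (fun t => f x t) y (fy x y)) ->
  (forall x y, Om (x, y) -> continuity_2d_pt fx x y) ->
  (forall x y, Om (x, y) -> continuity_2d_pt fy x y) ->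
  has_C0_gradient Om f fx fy.
Proof.
  intros HO Hd Hx Hy x y H.
  split_gradient; try apply Hd; auto.
  apply differentiable_continuity_pt. exists (fx x y), (fy x y).
  apply filterdiff_differentiable_pt_lim.
  apply filterdiff_ext_lin with
    (fun u : R * R => plus (scal (fst u) (fx x y)) (scal (snd u) (fy x y))).
  - apply (is_derive_filterdiff f x y fx).
    + apply filter_imp with (2 := HO _ H). intros [u v] Huv. apply Hd, Huv.
    + apply Hd, H.
    + apply (continuity_2d_pt_filterlim fx), Hx, H.
  - intros u. reflexivity.
Qed.

Lemma gradient_ext Om f fx fy fx' fy' :
  (forall x y, fx x y = fx' x y) -> (forall x y, fy x y = fy' x y) ->
  has_C0_gradient Om f fx fy -> has_C0_gradient Om f fx' fy'.
Proof.
  intros Hx Hy Hf x y H. destruct (Hf x y H) as (H0 & H1 & H2 & H3 & H4).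
  rewrite <- Hx, <- Hy. split_gradient; try assumption.
  - apply continuity_2d_pt_ext with fx; assumption.
  - apply continuity_2d_pt_ext with fy; assumption.
Qed.

Lemma gradient_const Om c :
  has_C0_gradient Om (fun _ _ => c) (fun _ _ => 0) (fun _ _ => 0).
Proof.
  intros x y _. split_gradient; try apply continuity_2d_pt_const;
    apply (is_derive_const (K := R_AbsRing) (V := R_NormedModule)).
Qed.

Lemma gradient_x Om :
  has_C0_gradient Om (fun x _ => x) (fun _ _ => 1) (fun _ _ => 0).
Proof.
  intros x y _. split_gradient; try apply continuity_2d_pt_const.
  - apply continuity_2d_pt_id1.
  - apply (is_derive_id (K := R_AbsRing)).
  - apply (is_derive_const (K := R_AbsRing) (V := R_NormedModule)).
Qed.

Lemma gradient_y Om :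
  has_C0_gradient Om (fun _ y => y) (fun _ _ => 0) (fun _ _ => 1).
Proof.
  intros x y _. split_gradient; try apply continuity_2d_pt_const.
  - apply continuity_2d_pt_id2.
  - apply (is_derive_const (K := R_AbsRing) (V := R_NormedModule)).
  - apply (is_derive_id (K := R_AbsRing)).
Qed.

Lemma gradient_plus Om f fx fy g gx gy :
  has_C0_gradient Om f fx fy -> has_C0_gradient Om g gx gy ->
  has_C0_gradient Om (fun x y => f x y + g x y)
    (fun x y => fx x y + gx x y) (fun x y => fy x y + gy x y).
Proof.
  intros Hf Hg x y H. destruct (Hf x y H) as (H0 & H1 & H2 & H3 & H4).
  destruct (Hg x y H) as (G0 & G1 & G2 & G3 & G4).
  split_gradient; try (apply continuity_2d_pt_plus; assumption).
  - exact (is_derive_plus _ _ _ _ _ H1 G1).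
  - exact (is_derive_plus _ _ _ _ _ H2 G2).
Qed.

Lemma gradient_mult Om f fx fy g gx gy :
  has_C0_gradient Om f fx fy -> has_C0_gradient Om g gx gy ->
  has_C0_gradient Om (fun x y => f x y * g x y)
    (fun x y => fx x y * g x y + f x y * gx x y)
    (fun x y => fy x y * g x y + f x y * gy x y).
Proof.
  intros Hf Hg x y H. destruct (Hf x y H) as (H0 & H1 & H2 & H3 & H4).
  destruct (Hg x y H) as (G0 & G1 & G2 & G3 & G4).
  split_gradient; try (apply continuity_2d_pt_mult; assumption);
    try (apply continuity_2d_pt_plus; apply continuity_2d_pt_mult; assumption).
  - apply (is_derive_mult (fun t => f t y) (fun t => g t y));
      try assumption. intros; apply Rmult_comm.
  - apply (is_derive_mult (fun t => f x t) (fun t => g x t));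
      try assumption. intros; apply Rmult_comm.
Qed.

Lemma gradient_scal Om k f fx fy : has_C0_gradient Om f fx fy ->
  has_C0_gradient Om (fun x y => k * f x y)
    (fun x y => k * fx x y) (fun x y => k * fy x y).
Proof.
  intros Hf. eapply gradient_ext;
    [| |apply gradient_mult; [apply (gradient_const Om k)|exact Hf]];
    intros; cbv beta; ring.
Qed.

Lemma gradient_minus Om f fx fy g gx gy :
  has_C0_gradient Om f fx fy -> has_C0_gradient Om g gx gy ->
  has_C0_gradient Om (fun x y => f x y - g x y)
    (fun x y => fx x y - gx x y) (fun x y => fy x y - gy x y).
Proof.
  intros Hf Hg x y H. destruct (Hf x y H) as (H0 & H1 & H2 & H3 & H4).
  destruct (Hg x y H) as (G0 & G1 & G2 & G3 & G4).
  split_gradient; try (apply continuity_2d_pt_minus; assumption).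
  - exact (is_derive_minus _ _ _ _ _ H1 G1).
  - exact (is_derive_minus _ _ _ _ _ H2 G2).
Qed.

(** The derivative of [a / w], simplified by [w^2 = area2 eps a b]. Exchanging [a] and [b] gives
    that of [b / w], and the [x] derivative of the first plus the [y] derivative of the second is
    [flux_divergence]. *)
Definition unit_quotient_derive (eps a b da db : R) : R :=
  ((1 + eps * b ^ 2) * da - eps * (a * b) * db) / sqrt (area2 eps a b) ^ 3.

Lemma is_derive_unit_quotient eps (f g : R -> R) t df dg :
  0 < area2 eps (f t) (g t) -> is_derive f t df -> is_derive g t dg ->
  is_derive (fun t => f t / sqrt (area2 eps (f t) (g t))) t
    (unit_quotient_derive eps (f t) (g t) df dg).
Proof.
  intros Hw Hf Hg.
  assert (Hw0 : 0 < sqrt (area2 eps (f t) (g t))) by (apply sqrt_lt_R0, Hw).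
  assert (Ha : is_derive (fun t => area2 eps (f t) (g t)) t
    (eps * (2 * f t * df + 2 * g t * dg))).
  { unfold area2. evar_last.
    - apply (is_derive_plus (fun _ : R => 1)).
      + apply (is_derive_const (K := R_AbsRing) (V := R_NormedModule)).
      + apply is_derive_scal.
        apply (is_derive_plus (fun t => f t ^ 2) (fun t => g t ^ 2));
          apply is_derive_pow; eassumption.
    - unfold plus, zero; simpl. ring. }
  evar_last.
  - apply (is_derive_div f (fun t => sqrt (area2 eps (f t) (g t))));
      [exact Hf| |lra].
    apply (is_derive_comp sqrt (fun t => area2 eps (f t) (g t))); [|exact Ha].
    apply is_derive_Reals, derivable_pt_lim_sqrt, Hw.
  - unfold unit_quotient_derive, scal; simpl; unfold mult; simpl.
    set (w := sqrt (area2 eps (f t) (g t))) in *.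
    assert (Hww : w * w = 1 + eps * (f t ^ 2 + g t ^ 2)).
    { unfold w. rewrite sqrt_sqrt by lra. reflexivity. }
    (* [1 + eps b^2 = w^2 - eps a^2] is the form in which the quotient rule delivers the
       numerator. *)
    replace ((1 + eps * (g t * (g t * 1))) * df)
      with ((w * w - eps * f t ^ 2) * df) by (rewrite Hww; ring).
    field. lra.
Qed.

Lemma gradient_unit_quotient Om eps f fx fy g gx gy :
  has_C0_gradient Om f fx fy -> has_C0_gradient Om g gx gy ->
  (forall x y, Om (x, y) -> 0 < area2 eps (f x y) (g x y)) ->
  has_C0_gradient Om (fun x y => f x y / sqrt (area2 eps (f x y) (g x y)))
    (fun x y => unit_quotient_derive eps (f x y) (g x y) (fx x y) (gx x y))
    (fun x y => unit_quotient_derive eps (f x y) (g x y) (fy x y) (gy x y)).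
Proof.
  intros Hf Hg Hw x y H. specialize (Hw x y H).
  destruct (Hf x y H) as (H0 & H1 & H2 & H3 & H4).
  destruct (Hg x y H) as (G0 & G1 & G2 & G3 & G4).
  assert (Hw0 : 0 < sqrt (area2 eps (f x y) (g x y))) by (apply sqrt_lt_R0, Hw).
  assert (Hp : forall u n, continuity_2d_pt u x y ->
    continuity_2d_pt (fun x y => u x y ^ n) x y).
  { intros u n Hu. induction n as [|n IH]; simpl;
      [apply continuity_2d_pt_const|apply continuity_2d_pt_mult; assumption]. }
  assert (Hcw : continuity_2d_pt (fun x y => sqrt (area2 eps (f x y) (g x y))) x y).
  { apply continuity_1d_2d_pt_comp; [apply continuity_pt_sqrt; lra|].
    unfold area2. apply continuity_2d_pt_plus; [apply continuity_2d_pt_const|].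
    apply continuity_2d_pt_mult; [apply continuity_2d_pt_const|].
    apply continuity_2d_pt_plus; apply Hp; assumption. }
  assert (Hnum : forall u v, continuity_2d_pt u x y -> continuity_2d_pt v x y ->
    continuity_2d_pt (fun x y =>
      unit_quotient_derive eps (f x y) (g x y) (u x y) (v x y)) x y).
  { intros u v Hu Hv. apply continuity_2d_pt_mult.
    - apply continuity_2d_pt_minus; apply continuity_2d_pt_mult; try assumption.
      + apply continuity_2d_pt_plus; [apply continuity_2d_pt_const|].
        apply continuity_2d_pt_mult; [apply continuity_2d_pt_const|apply Hp, G0].
      + apply continuity_2d_pt_mult; [apply continuity_2d_pt_const|].
        apply continuity_2d_pt_mult; assumption.
    - apply continuity_2d_pt_inv; [apply Hp, Hcw|].
      apply pow_nonzero; lra. }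
  split_gradient.
  - apply continuity_2d_pt_mult; [exact H0|].
    apply continuity_2d_pt_inv; [exact Hcw|lra].
  - apply (is_derive_unit_quotient eps (fun t => f t y) (fun t => g t y));
      assumption.
  - apply (is_derive_unit_quotient eps (fun t => f x t) (fun t => g x t));
      assumption.
  - apply Hnum; assumption.
  - apply Hnum; assumption.
Qed.

(** * From a graph to its twin *)

Lemma Ck_2_mixed Om u x y : open Om -> Ck_on 2 Om u -> Om (x, y) ->
  pdx (pdy u) x y = pdy (pdx u) x y.
Proof.
  intros HO Hu H. apply (Schwarz u).
  - generalize (open_locally_2d Om x y HO H).
    apply locally_2d_impl, locally_2d_forall. intros a b Hab.
    destruct (Hu a b Hab) as (_ & H1 & H2 & H3 & H4).
    refine (conj H1 (conj H2 (conj _ _))); [apply H4|apply H3].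
  - destruct (Hu x y H) as (_ & _ & _ & _ & H4). apply H4.
  - destruct (Hu x y H) as (_ & _ & _ & H3 & _). apply H3.
Qed.

Lemma slope_x_gradient Om eps sigma u :
  (forall x y, ex_diff_n sigma 1 x y) -> Ck_on 2 Om u ->
  has_C0_gradient Om (slope_x eps sigma u)
    (fun x y => pdx (pdx u) x y + eps * (y * pdx (Cfun sigma) x y))
    (fun x y => pdy (pdx u) x y
                + eps * (Cfun sigma x y + y * pdy (Cfun sigma) x y)).
Proof.
  intros Hs Hu.
  eapply gradient_ext; [| |apply gradient_plus;
    [apply (Ck_1_gradient Om (pdx u))|apply gradient_scal, gradient_mult;
      [apply gradient_y|apply (Ck_1_gradient Om (Cfun sigma))]]].
  - intros; cbv beta; ring.
  - intros; cbv beta; ring.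
  - intros x y H. apply (Hu x y H).
  - intros x y H. apply Cfun_C1, Hs.
Qed.

Lemma slope_y_gradient Om eps sigma u :
  (forall x y, ex_diff_n sigma 1 x y) -> open Om -> Ck_on 2 Om u ->
  has_C0_gradient Om (slope_y eps sigma u)
    (fun x y => pdx (pdy u) x y
                - eps * (Cfun sigma x y + x * pdx (Cfun sigma) x y))
    (fun x y => pdy (pdy u) x y - eps * (x * pdy (Cfun sigma) x y)).
Proof.
  intros Hs HO Hu.
  eapply gradient_ext; [| |apply gradient_minus;
    [apply (Ck_1_gradient Om (pdy u))|apply gradient_scal, gradient_mult;
      [apply gradient_x|apply (Ck_1_gradient Om (Cfun sigma))]]].
  - intros; cbv beta; ring.
  - intros; cbv beta; ring.
  - intros x y H. apply (Hu x y H).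
  - intros x y H. apply Cfun_C1, Hs.
Qed.

(** The common form of [riem_graph] and [spacelike_graph]: positivity of [area2] is automatic for
    [eps = 1] and means spacelike for [eps = -1]. *)
Definition is_graph (eps : R) (Om : R * R -> Prop) (sigma h u : R -> R -> R)
    : Prop :=
  Ck_on 2 Om u /\
  forall x y, Om (x, y) ->
    0 < area2 eps (slope_x eps sigma u x y) (slope_y eps sigma u x y) /\
    has_mean_curvature eps (bundle_metric eps sigma) u x y (h x y).

Lemma area2_sym eps a b : area2 eps a b = area2 eps b a.
Proof. unfold area2; ring. Qed.

(** This is [w' = 1 / w]. It makes the twin admissible and lets the twin relations be inverted. *)
Lemma area2_twin eps a b : eps * eps = 1 -> 0 < area2 eps a b ->
  let w := sqrt (area2 eps a b) in
  area2 (- eps) (- (eps * (b / w))) (eps * (a / w)) = (/ w) ^ 2.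
Proof.
  intros He Hw w.
  assert (Hw0 : 0 < w) by (apply sqrt_lt_R0, Hw).
  assert (Hww : w * w = 1 + eps * (a ^ 2 + b ^ 2)).
  { unfold w. rewrite sqrt_sqrt by lra. reflexivity. }
  clearbody w. unfold area2.
  apply Rmult_eq_reg_r with (w * w); [|nra].
  transitivity (w * w - eps * (eps * eps) * (a ^ 2 + b ^ 2)); [field; lra|].
  transitivity 1; [rewrite He, Hww; ring|field; lra].
Qed.

Theorem twin_graph eps Om sigma h u :
  eps * eps = 1 -> open Om -> simply_connected Om ->
  (forall x y, ex_diff_n sigma 1 x y) -> (forall x y, ex_diff_n h 1 x y) ->
  is_graph eps Om sigma h u ->
  exists v, is_graph (- eps) Om h sigma v /\
    forall x y, Om (x, y) ->
      let a := slope_x eps sigma u x y in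
      let b := slope_y eps sigma u x y in
      slope_x (- eps) h v x y = - (eps * (b / sqrt (area2 eps a b))) /\
      slope_y (- eps) h v x y = eps * (a / sqrt (area2 eps a b)).
Proof.
  intros He HO Hsc Hs Hh [Hu Hcurv].
  set (a := slope_x eps sigma u) in *. set (b := slope_y eps sigma u) in *.
  assert (Hw : forall x y, Om (x, y) -> 0 < area2 eps (a x y) (b x y))
    by (intros; apply Hcurv; assumption).
  pose proof (slope_x_gradient Om eps sigma u Hs Hu) as Ga. fold a in Ga.
  pose proof (slope_y_gradient Om eps sigma u Hs HO Hu) as Gb. fold b in Gb.
  set (ax := fun x y => pdx (pdx u) x y + eps * (y * pdx (Cfun sigma) x y)) in Ga.
  set (ay := fun x y => pdy (pdx u) x y
     + eps * (Cfun sigma x y + y * pdy (Cfun sigma) x y)) in Ga.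
  set (bx := fun x y => pdx (pdy u) x y
     - eps * (Cfun sigma x y + x * pdx (Cfun sigma) x y)) in Gb.
  set (by_ := fun x y => pdy (pdy u) x y - eps * (x * pdy (Cfun sigma) x y)) in Gb.
  set (qa := fun x y => a x y / sqrt (area2 eps (a x y) (b x y))).
  (* The arguments of [area2] are exchanged to match the quotient lemma with [b] in the
     numerator. *)
  set (qb := fun x y => b x y / sqrt (area2 eps (b x y) (a x y))).
  pose proof (gradient_unit_quotient Om eps a ax ay b bx by_ Ga Gb Hw) as Gqa.
  assert (Hw' : forall x y, Om (x, y) -> 0 < area2 eps (b x y) (a x y))
    by (intros; rewrite area2_sym; auto).
  pose proof (gradient_unit_quotient Om eps b bx by_ a ax ay Gb Ga Hw') as Gqb.
  fold qa in Gqa. fold qb in Gqb.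
  set (qax := fun x y =>
    unit_quotient_derive eps (a x y) (b x y) (ax x y) (bx x y)) in Gqa.
  set (qay := fun x y =>
    unit_quotient_derive eps (a x y) (b x y) (ay x y) (by_ x y)) in Gqa.
  set (qbx := fun x y =>
    unit_quotient_derive eps (b x y) (a x y) (bx x y) (ax x y)) in Gqb.
  set (qby := fun x y =>
    unit_quotient_derive eps (b x y) (a x y) (by_ x y) (ay x y)) in Gqb.
  assert (Hdiv : forall x y, Om (x, y) -> qax x y + qby x y = 2 * h x y).
  { intros x y H. destruct (Hcurv x y H) as [Hwp Hc].
    apply (has_mean_curvature_iff eps sigma u x y _ Hs He Hwp) in Hc.
    rewrite Hc. fold a b. unfold qax, qby, unit_quotient_derive, flux_divergence.
    rewrite (area2_sym eps (b x y)).
    replace (2 * pdy (pdx u) x y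
      + eps * (y * pdy (Cfun sigma) x y - x * pdx (Cfun sigma) x y))
      with (ay x y + bx x y)
      by (unfold ay, bx; rewrite (Ck_2_mixed Om u x y HO Hu H); ring).
    unfold Rdiv. fold (ax x y) (by_ x y). ring. }
  set (C := Cfun h).
  assert (GC : has_C0_gradient Om C (pdx C) (pdy C)).
  { apply Ck_1_gradient. intros x y _. apply Cfun_C1, Hh. }
  (* [P] and [Q] are what the twin relations prescribe for the partial derivatives of [v], once the
     terms in [C] are moved across. *)
  set (P := fun x y => eps * (y * C x y - qb x y)).
  set (Q := fun x y => eps * (qa x y - x * C x y)).
  set (Px := fun x y => eps * (y * pdx C x y - qbx x y)).
  set (Py := fun x y => eps * (C x y + y * pdy C x y - qby x y)).
  set (Qx := fun x y => eps * (qax x y - (C x y + x * pdx C x y))).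
  set (Qy := fun x y => eps * (qay x y - x * pdy C x y)).
  assert (GP : has_C0_gradient Om P Px Py).
  { eapply gradient_ext; [| |apply gradient_scal, gradient_minus;
      [apply gradient_mult; [apply gradient_y|exact GC]|exact Gqb]];
      intros; unfold Px, Py; ring. }
  assert (GQ : has_C0_gradient Om Q Qx Qy).
  { eapply gradient_ext; [| |apply gradient_scal, gradient_minus;
      [exact Gqa|apply gradient_mult; [apply gradient_x|exact GC]]];
      intros; unfold Qx, Qy; ring. }
  (* [Py - Qx] is [eps] times [2 C + x C_x + y C_y] minus the divergence of [(qa, qb)]; both equal
     [2 h]. *)
  assert (Hclosed : forall x y, Om (x, y) -> Py x y = Qx x y).
  { intros x y H. unfold Py, Qx.
    pose proof (Hdiv x y H) as Hd. rewrite <- (Cfun_euler h x y Hh) in Hd.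
    fold C in Hd. f_equal. lra. }
  destruct (closed_form_exact Om P Q HO Hsc) as [v Hv].
  { apply (gradient_Ck_1 Om P Px Py HO GP). }
  { apply (gradient_Ck_1 Om Q Qx Qy HO GQ). }
  { intros x y H. destruct (gradient_pd Om P Px Py x y GP H) as [_ ->].
    destruct (gradient_pd Om Q Qx Qy x y GQ H) as [-> _]. apply Hclosed, H. }
  assert (Gv : has_C0_gradient Om v P Q).
  { apply gradient_of_derivatives; [exact HO|exact Hv| |].
    - intros x y H. apply (GP x y H).
    - intros x y H. apply (GQ x y H). }
  assert (Hsl : forall x y, Om (x, y) ->
    slope_x (- eps) h v x y
    = - (eps * (b x y / sqrt (area2 eps (a x y) (b x y)))) /\
    slope_y (- eps) h v x y
    = eps * (a x y / sqrt (area2 eps (a x y) (b x y)))).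
  { intros x y H. unfold slope_x, slope_y.
    destruct (gradient_pd Om v P Q x y Gv H) as [-> ->].
    unfold P, Q, qb, qa. rewrite (area2_sym eps (b x y)).
    fold C. split; ring. }
  exists v. split; [|exact Hsl].
  split.
  { apply (gradient_Ck_S 1 Om v P Q HO Gv).
    - apply (gradient_Ck_1 Om P Px Py HO GP).
    - apply (gradient_Ck_1 Om Q Qx Qy HO GQ). }
  intros x y H. destruct (Hsl x y H) as [Hsx Hsy].
  pose proof (area2_twin eps (a x y) (b x y) He (Hw x y H)) as Htw.
  cbv zeta in Htw. rewrite <- Hsx, <- Hsy in Htw.
  pose proof (sqrt_lt_R0 _ (Hw x y H)) as Hw0.
  assert (Hpos : 0 < area2 (- eps) (slope_x (- eps) h v x y)
                   (slope_y (- eps) h v x y)).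
  { rewrite Htw. apply pow_lt, Rinv_0_lt_compat, Hw0. }
  split; [exact Hpos|].
  apply has_mean_curvature_iff; [exact Hh|lra|exact Hpos|].
  destruct (gradient_pd2 Om (pdx v) P Px Py x y HO
    (fun x y H => proj1 (gradient_pd Om v P Q x y Gv H)) GP H) as [-> Exy].
  destruct (gradient_pd2 Om (pdy v) Q Qx Qy x y HO
    (fun x y H => proj2 (gradient_pd Om v P Q x y Gv H)) GQ H) as [_ ->].
  rewrite <- (Cfun_euler sigma x y Hs).
  unfold flux_divergence. rewrite Htw, Hsx, Hsy.
  rewrite sqrt_pow2 by (apply Rlt_le, Rinv_0_lt_compat, Hw0).
  (* Writing [2 v_xy] symmetrically as [Py + Qx] makes the derivatives of [C] cancel. *)
  replace (2 * pdy (pdx v) x y + - eps * (y * pdy (Cfun h) x y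
             - x * pdx (Cfun h) x y)) with (eps * (qax x y - qby x y)).
  2: { pose proof (Hclosed x y H) as Hcl.
       replace (2 * pdy (pdx v) x y) with (Py x y + Qx x y) by lra.
       unfold Py, Qx. fold C. ring. }
  replace (Px x y + - eps * (y * pdx (Cfun h) x y)) with (- eps * qbx x y)
    by (unfold Px; fold C; ring).
  replace (Qy x y - - eps * (x * pdy (Cfun h) x y)) with (eps * qay x y)
    by (unfold Qy; fold C; ring).
  unfold qax, qay, qbx, qby, unit_quotient_derive.
  rewrite (area2_sym eps (b x y)).
  (* The intermediate term separates the curl identity of the original graph,
     [a_y - b_x = 2 eps sigma], from pure algebra in [a], [b], [w]. *)
  transitivity (eps * (ay x y - bx x y)).
  { unfold ay, bx. rewrite (Ck_2_mixed Om u x y HO Hu H).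
    transitivity (eps * eps * (2 * Cfun sigma x y + x * pdx (Cfun sigma) x y
      + y * pdy (Cfun sigma) x y)); [rewrite He; ring|ring]. }
  set (w := sqrt (area2 eps (a x y) (b x y))) in *.
  assert (Hww : w * w = 1 + eps * (a x y ^ 2 + b x y ^ 2)).
  { unfold w. rewrite sqrt_sqrt by (apply Rlt_le, Hw, H). reflexivity. }
  clearbody w. clear - Hww Hw0 He.
  generalize (a x y) (b x y) (ax x y) (ay x y) (bx x y) (by_ x y) Hww.
  clear Hww. intros A B Ax Ay Bx By Hww.
  assert (He' : eps = 1 \/ eps = - 1).
  { destruct (Rmult_integral (eps - 1) (eps + 1)); [lra|left|right]; lra. }
  (* For the twin slope [a' = - eps B / w] or [b' = eps A / w], the coefficients [1 - eps a'^2] and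
     [1 - eps b'^2] are [(1 + eps A^2) / w^2] and [(1 + eps B^2) / w^2], again by
     [w^2 = 1 + eps (A^2 + B^2)]. *)
  assert (HB : forall D, (1 + - eps * (eps * (A / w)) ^ 2) * D
    = (1 + eps * B ^ 2) / w ^ 2 * D).
  { intros D. f_equal. apply Rmult_eq_reg_r with (w * w); [|nra].
    transitivity (w * w - eps * (eps * eps) * A ^ 2); [field; lra|].
    rewrite He, Hww. transitivity (1 + eps * B ^ 2);
      [ring|rewrite <- Hww; field; lra]. }
  assert (HA : forall D, (1 + - eps * (- (eps * (B / w))) ^ 2) * D
    = (1 + eps * A ^ 2) / w ^ 2 * D).
  { intros D. f_equal. apply Rmult_eq_reg_r with (w * w); [|nra].
    transitivity (w * w - eps * (eps * eps) * B ^ 2); [field; lra|].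
    rewrite He, Hww. transitivity (1 + eps * A ^ 2);
      [ring|rewrite <- Hww; field; lra]. }
  rewrite HA, HB. apply Rmult_eq_reg_r with (w * w); [|nra].
  (* With [w^2] expanded on this side only, the rest is an identity of rational functions in which
     [w] is a free variable. *)
  transitivity (eps * (Ay - Bx) * (1 + eps * (A ^ 2 + B ^ 2)));
    [rewrite Hww; reflexivity|].
  clear - He' Hw0. destruct He' as [-> | ->]; field; lra.
Qed.

(** * Riemannian and spacelike graphs as the two signs *)

Lemma riem_graph_iff Om sigma h u :
  riem_graph Om sigma h u <-> is_graph 1 Om sigma h u.
Proof.
  split; intros [H1 H2]; (split; [exact H1|]); intros x y H.
  - split; [|apply H2, H]. unfold area2.
    pose proof (pow2_ge_0 (slope_x 1 sigma u x y)).
    pose proof (pow2_ge_0 (slope_y 1 sigma u x y)). lra.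
  - apply H2, H.
Qed.

Lemma spacelike_at_iff sigma u x y :
  spacelike_at (Lorentz3 sigma) u x y <->
  0 < area2 (- 1) (slope_x (- 1) sigma u x y) (slope_y (- 1) sigma u x y).
Proof.
  set (a := slope_x (- 1) sigma u x y). set (b := slope_y (- 1) sigma u x y).
  assert (E : forall s t, Lorentz3 sigma (graph_pt u x y)
      (plus (scal s (graph_X u x y)) (scal t (graph_Y u x y)))
      (plus (scal s (graph_X u x y)) (scal t (graph_Y u x y)))
    = s * s + t * t - (s * a + t * b) * (s * a + t * b)).
  { intros s t.
    replace (plus (scal s (graph_X u x y)) (scal t (graph_Y u x y)))
      with ((s, t, s * pdx u x y + t * pdy u x y) : vec3).
    2: { change ((s, t, s * pdx u x y + t * pdy u x y)
           = (s * 1 + t * 0, s * 0 + t * 1, s * pdx u x y + t * pdy u x y)).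
         rewrite !Rmult_1_r, !Rmult_0_r, Rplus_0_r, Rplus_0_l. reflexivity. }
    unfold a, b, slope_x, slope_y, Lorentz3, bundle_metric, bundle_form,
      graph_pt, cx, cy, cz; simpl. ring. }
  unfold spacelike_at, area2. split.
  (* The test vector is [(a, b)]: with [r = a^2 + b^2] it gives [r - r^2 > 0]. It must be nonzero,
     hence the separate case [r = 0]. *)
  - intros H. destruct (Req_dec (a ^ 2 + b ^ 2) 0) as [H0|H0]; [rewrite H0; lra|].
    assert (Hab : (a, b) <> (0, 0)).
    { intros Hab. injection Hab as Ha Hb. apply H0. rewrite Ha, Hb. ring. }
    specialize (H a b Hab). cbv zeta in H. rewrite E in H.
    pose proof (pow2_ge_0 a). pose proof (pow2_ge_0 b). nra.
  - intros H s t Hst. cbv zeta. rewrite E.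
    assert (Hp : 0 < s * s + t * t).
    { destruct (Req_dec s 0) as [->|Hs]; [destruct (Req_dec t 0) as [->|Ht]|].
      - destruct Hst; reflexivity.
      - nra.
      - nra. }
    (* Cauchy-Schwarz *)
    pose proof (pow2_ge_0 (s * b - t * a)). nra.
Qed.

Lemma spacelike_graph_iff Om sigma h u :
  spacelike_graph Om sigma h u <-> is_graph (- 1) Om sigma h u.
Proof.
  split; intros [H1 H2]; (split; [exact H1|]); intros x y H;
    destruct (H2 x y H) as [H3 H4]; (split; [|exact H4]);
    apply spacelike_at_iff; exact H3.
Qed.

Lemma riem_slopes sigma u x y :
  slope_x 1 sigma u x y = pdx u x y + y * Cfun sigma x y /\
  slope_y 1 sigma u x y = pdy u x y - x * Cfun sigma x y.
Proof. unfold slope_x, slope_y. split; ring. Qed.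

Lemma lorentz_slopes sigma u x y :
  slope_x (- 1) sigma u x y = pdx u x y - y * Cfun sigma x y /\
  slope_y (- 1) sigma u x y = pdy u x y + x * Cfun sigma x y.
Proof. unfold slope_x, slope_y. split; ring. Qed.

Lemma riem_area2 a b : area2 1 a b = 1 + a ^ 2 + b ^ 2.
Proof. unfold area2. ring. Qed.

Lemma smooth_C1 sigma : smooth sigma -> forall x y, ex_diff_n sigma 1 x y.
Proof. intros H x y. apply H. Qed.

(** The functions [tau1] and [tau2] exchange roles: each is the bundle curvature of one space and
    the mean curvature of the graph in the other. *)
Theorem spacelike_twin Om tau1 tau2 f :
  smooth tau1 -> smooth tau2 -> open Om -> simply_connected Om ->
  riem_graph Om tau1 tau2 f ->
  exists g, spacelike_graph Om tau2 tau1 g /\ twin Om tau1 tau2 f g.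
Proof.
  intros S1 S2 HO Hsc Hf. apply riem_graph_iff in Hf.
  destruct (twin_graph 1 Om tau1 tau2 f ltac:(ring) HO Hsc (smooth_C1 _ S1)
    (smooth_C1 _ S2) Hf) as (g & Hg & Ht).
  exists g. split; [apply spacelike_graph_iff; exact Hg|].
  intros x y H. specialize (Ht x y H). cbv zeta in Ht |- *.
  destruct (riem_slopes tau1 f x y) as [<- <-].
  destruct (lorentz_slopes tau2 g x y) as [<- <-].
  rewrite <- riem_area2. rewrite !Rmult_1_l in Ht. exact Ht.
Qed.

(** For [eps = -1] the construction yields the second form of the twin relations, [(alpha, beta) =
    (beta' / w', - alpha' / w')]; the first form follows from [omega = 1 / w']. *)
Theorem riem_twin Om tau1 tau2 g :
  smooth tau1 -> smooth tau2 -> open Om -> simply_connected Om ->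
  spacelike_graph Om tau2 tau1 g ->
  exists f, riem_graph Om tau1 tau2 f /\ twin Om tau1 tau2 f g.
Proof.
  intros S1 S2 HO Hsc Hg. apply spacelike_graph_iff in Hg.
  destruct (twin_graph (- 1) Om tau2 tau1 g ltac:(ring) HO Hsc (smooth_C1 _ S2)
    (smooth_C1 _ S1) Hg) as (f & Hf & Ht).
  replace (- - 1) with 1 in * by ring.
  exists f. split; [apply riem_graph_iff; exact Hf|].
  intros x y H. specialize (Ht x y H). cbv zeta in Ht |- *.
  destruct (riem_slopes tau1 f x y) as [<- <-].
  destruct (lorentz_slopes tau2 g x y) as [<- <-].
  rewrite <- riem_area2.
  pose proof (proj1 (proj2 Hg x y H)) as Hpos.
  pose proof (area2_twin (- 1) _ _ ltac:(ring) Hpos) as Htw. cbv zeta in Htw.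
  destruct Ht as [Hx Hy]. rewrite <- Hx, <- Hy in Htw.
  replace (- - 1) with 1 in Htw by ring.
  pose proof (sqrt_lt_R0 _ Hpos) as Hw.
  rewrite Htw, sqrt_pow2 by (apply Rlt_le, Rinv_0_lt_compat, Hw).
  rewrite Hx, Hy. split; field; lra.
Qed.

Lemma smooth_zero : smooth zero_fun.
Proof.
  (* The induction covers every function that vanishes pointwise, because the partial derivatives of
     zero are equal to zero only pointwise. *)
  assert (H : forall k f, (forall x y, f x y = 0) ->
    forall x y, ex_diff_n f k x y).
  { induction k as [|k IH]; intros f Hf x y;
      (assert (Hc : continuity_2d_pt f x y)
         by (apply continuity_2d_pt_ext with (fun _ _ => 0);
             [intros; symmetry; apply Hf|apply continuity_2d_pt_const])).
    - split; [exact Hc|exact I].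
    - assert (Hx : forall x y, is_derive (fun t => f t y) x 0).
      { intros. apply is_derive_ext with (fun _ : R => 0);
          [intros; symmetry; apply Hf|].
        apply (is_derive_const (K := R_AbsRing) (V := R_NormedModule)). }
      assert (Hy : forall x y, is_derive (fun t => f x t) y 0).
      { intros. apply is_derive_ext with (fun _ : R => 0);
          [intros; symmetry; apply Hf|].
        apply (is_derive_const (K := R_AbsRing) (V := R_NormedModule)). }
      split; [exact Hc|]. split; [eexists; apply Hx|].
      split; [eexists; apply Hy|].
      split; apply IH; intros; apply is_derive_unique; [apply Hx|apply Hy]. }
  intros k x y. apply H. reflexivity.
Qed.

Theorem corollary7 :
  forall (H : R -> R -> R) (Om : R * R -> Prop),
    smooth H -> open Om -> simply_connected Om ->
    ((forall f : R -> R -> R, riem_graph Om zero_fun H f ->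
        exists g : R -> R -> R,
          spacelike_graph Om H zero_fun g /\ twin Om zero_fun H f g) /\
     (forall g : R -> R -> R, spacelike_graph Om H zero_fun g ->
        exists f : R -> R -> R,
          riem_graph Om zero_fun H f /\ twin Om zero_fun H f g)) /\
    ((forall g : R -> R -> R, spacelike_graph Om zero_fun H g ->
        exists f : R -> R -> R,
          riem_graph Om H zero_fun f /\ twin Om H zero_fun f g) /\
     (forall f : R -> R -> R, riem_graph Om H zero_fun f ->
        exists g : R -> R -> R,
          spacelike_graph Om zero_fun H g /\ twin Om H zero_fun f g)).
Proof.
  intros H Om HH HO Hsc. split; split; intros u Hu.
  - apply spacelike_twin; auto using smooth_zero.
  - apply riem_twin; auto using smooth_zero.
  - apply riem_twin; auto using smooth_zero.
  - apply spacelike_twin; auto using smooth_zero.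
Qed.
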